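(* Let $(\mathbf v^n,\mathbf Q^n)$, $n=0,\dots,N_t$, be a solution of the SGE-PDG scheme (defined in the context) with time step $\tau>0$ and stabilization parameter $\kappa$. For $n\ge1$ define $$\begin{aligned}E^n_{\rm PDG}={}&\int_\Omega\Big[\tfrac12\tfrac{|\mathbf v^{n-1}|^2+|\mathbf v^n|^2}{2}+\tfrac K2\tfrac{|\nabla\mathbf Q^{n-1}|^2+|\nabla\mathbf Q^n|^2}{2}+\tfrac W2\tfrac{|\mathbf Q^{n-1}-\mathbf Q_\star|^2+|\mathbf Q^n-\mathbf Q_\star|^2}{2}+\tfrac\kappa4|\mathbf Q^n-\mathbf Q^{n-1}|^2\Big]d\mathbf x\\&+\overline F_{\rm bulk}(\mathbf Q^{n-1},\mathbf Q^n).\end{aligned}$$ Then for every $1\le n\le N_t-1$, $$E^{n+1}_{\rm PDG}-E^n_{\rm PDG}=-2\tau\|\sqrt\eta\,\mathbf D^{\overline n}\|^2-\tau\|\sqrt b\,\mathbf v^{\overline n}\|^2-\tau\|\sqrt{\Gamma_{\mathbf Q}}\,\overline{\mathbf H}^n\|^2+\tau(\mathbf Q^n,\chi\mathbf D^{\overline n}-\xi\overline{\mathbf H}^n).$$ Consequently, in the passive case $\chi=\xi=0$ the scheme is unconditionally energy stable: $E^{n+1}_{\rm PDG}\le E^n_{\rm PDG}$ for every $\tau>0$.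
   Context: Notation. $d\in\{2,3\}$, $\Omega\subset\mathbb R^d$ is a square (cubic) domain with outward normal $\mathbf n$. $\mathcal M_0$ is the space of real symmetric trace-free $d\times d$ matrices. $\mathbf P:\mathbf Q=\mathrm{tr}(\mathbf P^\top\mathbf Q)$, $|\mathbf Q|^2=\mathbf Q:\mathbf Q$; $(\cdot,\cdot)$ and $\|\cdot\|$ are the $L^2(\Omega)$ inner product and norm for scalar, vector and tensor fields. $[\nabla\mathbf v]_{ij}=\partial_jv_i$, $\mathbf D(\mathbf v)=\frac12(\nabla\mathbf v+\nabla\mathbf v^\top)$, $\boldsymbol\Omega(\mathbf v)=\frac12(\nabla\mathbf v-\nabla\mathbf v^\top)$; $[\nabla\cdot\boldsymbol\tau]_i=\partial_j\tau_{ij}$; $[\nabla\cdot(K\nabla\mathbf Q)]_{ij}=\partial_k(K\partial_kQ_{ij})$; $(\mathbf v\cdot\nabla\mathbf Q)_{ij}=v_k\partial_kQ_{ij}$; $(\mathbf H:\nabla\mathbf Q)_k=H_{ij}\partial_kQ_{ij}$. A dot between matrices is the matrix product. For any sequence, $(\bullet)^{\overline n}=\frac12((\bullet)^{n+1}+(\bullet)^{n-1})$, and $\mathbf D^{\overline n}=\mathbf D(\mathbf v^{\overline n})$. All fields are assumed regular enough for the formulas and integrations by parts to make sense. Coefficients. $\phi:\overline\Omega\to[0,1]$ is a prescribed time-independent function and $b=b_{solid}(1-\phi)\ge0$, $\eta=\eta_{fluid}\phi+\eta_{solid}(1-\phi)\ge0$, $\xi=\xi_{fluid}\phi$, $\chi=\chi_{fluid}\phi$,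 $K=K_{fluid}\phi\ge0$, $\Gamma_{\mathbf Q}=\Gamma_{fluid}\phi+\Gamma_{solid}(1-\phi)\ge0$, $W=W_0|\nabla\phi|\ge0$, $N=N_{fluid}\phi+N_{solid}(1-\phi)\ge0$, $\alpha=A(1-N/3)$, $\beta=\gamma=AN$ with a constant $A>0$; $a\in\mathbb R$ is a constant; $\xi_{fluid},\chi_{fluid}\in\mathbb R$ (activity). $\mathbf Q_\star$ is a given $\mathcal M_0$-valued field. Bulk terms. $f_{\rm bulk}(\mathbf Q)=\alpha\mathbf Q-\beta(\mathbf Q^2-\frac{\mathrm{tr}(\mathbf Q^2)}{d}\mathbf I)+\gamma\,\mathrm{tr}(\mathbf Q^2)\mathbf Q$. Polarized bulk energy: $$\overline F_{\rm bulk}(\mathbf U,\mathbf V)=\int_\Omega\Big[\tfrac\alpha2\tfrac{\mathrm{tr}(\mathbf U^2)+\mathrm{tr}(\mathbf V^2)}2-\tfrac\beta3\mathrm{tr}\big(\mathbf U\mathbf V\tfrac{\mathbf U+\mathbf V}2\big)+\tfrac\gamma4\mathrm{tr}(\mathbf U^2)\mathrm{tr}(\mathbf V^2)\Big]d\mathbf x.$$ Polarized discrete gradient: $$\overline f_{\rm bulk}(\mathbf U,\mathbf V,\mathbf W)=\tfrac\alpha2\tfrac{\mathbf U+\mathbf W}2-\tfrac\beta6\Big[\mathbf V^2+\mathbf V\tfrac{\mathbf U+\mathbf W}2+\tfrac{\mathbf U+\mathbf W}2\mathbf V-\tfrac1d\mathrm{tr}(\mathbf V(\mathbf U+\mathbf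 V+\mathbf W))\mathbf I\Big]+\tfrac\gamma2\mathrm{tr}(\mathbf V^2)\tfrac{\mathbf U+\mathbf W}2.$$ Explicit terms. With $\mathbf H^n=\nabla\cdot(K\nabla\mathbf Q^n)-f_{\rm bulk}(\mathbf Q^n)-W(\mathbf Q^n-\mathbf Q_\star)$: $\mathbf g_{\mathbf v}^n=\mathbf v^n$, $\mathbf G_{\mathbf Q}^n=-\mathbf H^n$, $\mathbf c_{\mathbf v}^n=-\mathbf v^n\cdot\nabla\mathbf v^n+\nabla\cdot\boldsymbol\Sigma^n-\mathbf H^n:\nabla\mathbf Q^n$, $\mathbf C_{\mathbf Q}^n=-\mathbf v^n\cdot\nabla\mathbf Q^n+\mathbf S^n$, $\mathbf f_{\mathbf v}^n=-\nabla\cdot(\chi\mathbf Q^n)$, $\mathbf F_{\mathbf Q}^n=\xi\mathbf Q^n$, where, at time level $n$, $\boldsymbol\Sigma=\mathbf Q\cdot\mathbf H-\mathbf H\cdot\mathbf Q-a(\mathbf Q\cdot\mathbf H+\mathbf H\cdot\mathbf Q)-\frac{2a}{d}\mathbf H+2a(\mathbf Q:\mathbf H)(\mathbf Q+\frac1d\mathbf I)$ and $\mathbf S=\boldsymbol\Omega\cdot\mathbf Q-\mathbf Q\cdot\boldsymbol\Omega+a(\mathbf Q\cdot\mathbf D+\mathbf D\cdot\mathbf Q)+\frac{2a}{d}\mathbf D-2a(\mathbf D:\mathbf Q)(\mathbf Q+\frac1d\mathbf I)$. $\mathcal G(\mathbf g,\mathbf G)=\|\mathbf g\|^2+\|\mathbf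 G\|^2$. SGE-PDG scheme. Given $(\mathbf v^0,\mathbf Q^0)$, $(\mathbf v^1,\mathbf Q^1)$ with $\mathbf v^0,\mathbf v^1$ divergence free and $\mathbf Q^0,\mathbf Q^1$ $\mathcal M_0$-valued, for $n=1,\dots,N_t-1$ the fields $\mathbf v^{n+1}$, $p^{\overline n}$, the $\mathcal M_0$-valued field $\mathbf Q^{n+1}$ and scalars $\overline\zeta^n,\overline\omega^n$ satisfy $$\tfrac{\mathbf v^{n+1}-\mathbf v^{n-1}}{2\tau}=-\nabla p^{\overline n}+2\nabla\cdot(\eta\mathbf D^{\overline n})-b\mathbf v^{\overline n}+\overline\zeta^n\mathbf c_{\mathbf v}^n-\overline\omega^n\mathbf g_{\mathbf v}^n+\mathbf f_{\mathbf v}^n,\qquad\nabla\cdot\mathbf v^{\overline n}=0,$$ $$\tfrac{\mathbf Q^{n+1}-\mathbf Q^{n-1}}{2\tau}=\Gamma_{\mathbf Q}\overline{\mathbf H}^n+\overline\zeta^n\mathbf C_{\mathbf Q}^n-\overline\omega^n\mathbf G_{\mathbf Q}^n+\mathbf F_{\mathbf Q}^n,$$ $$\overline\zeta^n=\tfrac{(\overline{\mathbf g}_{\mathbf v}^n,\mathbf g_{\mathbf v}^n)+(\overline{\mathbf G}_{\mathbf Q}^n,\mathbf G_{\mathbf Q}^n)}{\mathcal G(\mathbf g_{\mathbf v}^n,\mathbf G_{\mathbf Q}^n)},\qquad\overline\omega^n=\tfrac{(\overline{\mathbf g}_{\mathbf v}^n,\mathbf c_{\mathbf v}^n)+(\overline{\mathbf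 G}_{\mathbf Q}^n,\mathbf C_{\mathbf Q}^n)}{\mathcal G(\mathbf g_{\mathbf v}^n,\mathbf G_{\mathbf Q}^n)},$$ where $\overline{\mathbf g}_{\mathbf v}^n=\mathbf v^{\overline n}$, $\overline{\mathbf G}_{\mathbf Q}^n=-\overline{\mathbf H}^n$ and $$\overline{\mathbf H}^n=\nabla\cdot(K\nabla\mathbf Q^{\overline n})-W(\mathbf Q^{\overline n}-\mathbf Q_\star)-\kappa(\mathbf Q^{\overline n}-\mathbf Q^n)-2\overline f_{\rm bulk}(\mathbf Q^{n-1},\mathbf Q^n,\mathbf Q^{n+1}).$$ Boundary conditions: $\mathbf v^n|_{\partial\Omega}=0$ and, for all $n$, either $\mathbf Q^n|_{\partial\Omega}=\mathbf Q_D$ (fixed, $\mathcal M_0$-valued) or $\partial_{\mathbf n}\mathbf Q^n|_{\partial\Omega}=0$. It is assumed that $\mathcal G(\mathbf g_{\mathbf v}^n,\mathbf G_{\mathbf Q}^n)\ne0$ at every step. *)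

(* Defs.v *)
From HB Require Import structures.
From mathcomp Require Import all_boot all_order all_algebra.
From mathcomp Require Import all_classical all_reals all_analysis.

Set Implicit Arguments.
Unset Strict Implicit.
Unset Printing Implicit Defensive.

Import Order.TTheory GRing.Theory Num.Theory.
Import numFieldNormedType.Exports.

Local Open Scope classical_set_scope.
Local Open Scope ring_scope.

(* Lebesgue measure on n.-tuple R, as the n-fold product of lebesgue_measure:
   lebesgue_cons mu is the image of lebesgue_measure \x mu under
   (x, t) |-> x :: t. *)
Section lebesgue_cons.
Context (R : realType) (n : nat).
Local Notation T := (measurableTypeR R).
Variable (mu : {sigma_finite_measure set (n.-tuple T) -> \bar R}).

Definition cons_pair (p : T * n.-tuple T) : n.+1.-tuple T := [tuple of p.1 :: p.2].

Let measurable_cons_pair : measurable_fun setT cons_pair.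
Proof. exact: measurable_cons. Qed.

Definition lebesgue_cons : set (n.+1.-tuple T) -> \bar R :=
  pushforward (@lebesgue_measure R \x mu)%E cons_pair.

Let measurable_pre A : measurable A -> measurable (cons_pair @^-1` A).
Proof. by move=> mA; rewrite -[X in measurable X]setTI; exact: measurable_cons_pair. Qed.

Let lebesgue_cons0 : lebesgue_cons set0 = 0%E.
Proof. by rewrite /lebesgue_cons/pushforward preimage_set0 measure0. Qed.

Let lebesgue_cons_ge0 A : (0 <= lebesgue_cons A)%E.
Proof. exact: (measure_ge0 (@lebesgue_measure R \x mu)%E). Qed.

Let lebesgue_cons_sigma_additive : semi_sigma_additive lebesgue_cons.
Proof.
move=> F mF tF mUF; rewrite /lebesgue_cons /pushforward preimage_bigcup.
apply: (@measure_semi_sigma_additive _ _ _ (@lebesgue_measure R \x mu)%E); first by move=> i; exact: measurable_pre.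
- apply/trivIsetP => /= i j _ _ ij; rewrite -preimage_setI.
  by move/trivIsetP : tF => /(_ _ _ _ _ ij) ->//; rewrite preimage_set0.
- by rewrite -preimage_bigcup; exact: measurable_pre.
Qed.

HB.instance Definition _ := isMeasure.Build _ _ _ lebesgue_cons
  lebesgue_cons0 lebesgue_cons_ge0 lebesgue_cons_sigma_additive.

Let lebesgue_cons_sigma_finite : sigma_finite setT lebesgue_cons.
Proof.
have /sigma_finiteP[F [TF ndF Foo]] := sigma_finiteT (@lebesgue_measure R).
have /sigma_finiteP[G [TG ndG Goo]] := sigma_finiteT mu.
pose u (t : n.+1.-tuple T) : T * n.-tuple T := (thead t, [tuple of behead t]).
have mu_ : measurable_fun setT u.
  apply/measurable_fun_pairP; split; first exact: measurable_tnth.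
  exact: measurable_behead.
have uK : u \o cons_pair = id.
  by apply/funext => -[x t]; congr pair; apply/val_inj.
exists (fun i => u @^-1` (F i `*` G i)).
  apply/esym; rewrite -subTset => t _.
  have [i _ Fi] : (\bigcup_i F i) (u t).1 by rewrite -TF.
  have [j _ Gj] : (\bigcup_i G i) (u t).2 by rewrite -TG.
  exists (maxn i j) => //; split.
    by move: Fi; exact/subsetPset/ndF/leq_maxl.
  by move: Gj; exact/subsetPset/ndG/leq_maxr.
move=> k; have [mFk Fk] := Foo k; have [mGk Gk] := Goo k; split.
  by rewrite -[X in measurable X]setTI; apply: mu_=> //; exact: measurableX.
rewrite /lebesgue_cons /pushforward -comp_preimage uK preimage_id.
rewrite product_measure1E//.
by rewrite lte_mul_pinfty// ge0_fin_numE.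
Qed.

HB.instance Definition _ := Measure_isSigmaFinite.Build _ _ _ lebesgue_cons
  lebesgue_cons_sigma_finite.
End lebesgue_cons.

Fixpoint lebesgue_tuple (R : realType) (n : nat) :
    {sigma_finite_measure set (n.-tuple (measurableTypeR R)) -> \bar R} :=
  match n with
  | 0 => @dirac _ (0.-tuple (measurableTypeR R)) [tuple] R
  | m.+1 => lebesgue_cons (lebesgue_tuple R m)
  end.

Section cube.
Context {R : realType} {d : nat}.
Implicit Types (f : 'rV[R]_d -> R) (x c : 'rV[R]_d) (L : R).

Definition cube c L : set 'rV[R]_d :=
  [set x | forall i, c 0 i < x 0 i < c 0 i + L].

Definition closed_cube c L : set 'rV[R]_d :=
  [set x | forall i, c 0 i <= x 0 i <= c 0 i + L].

Definition cube_boundary c L : set 'rV[R]_d := closed_cube c L `\` cube c L.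

(* The normal is only defined in the relative interior of the faces. *)
Definition outward_normal c L x (nu : 'rV[R]_d) : Prop :=
  exists2 i : 'I_d, forall j, j != i -> c 0 j < x 0 j < c 0 j + L &
    (x 0 i = c 0 i /\ nu = - delta_mx 0 i) \/
    (x 0 i = c 0 i + L /\ nu = delta_mx 0 i).

Definition cube_integral c L f : R :=
  \int[lebesgue_tuple R d]_(t in [set t | cube c L (\row_i tnth t i)])
    f (\row_i tnth t i).

Definition partial (k : 'I_d) f x : R := 'D_(delta_mx 0 k) f x.

(* C^k up to the boundary: the derivatives of order <= k exist in the open cube
   and have continuous extensions to the closed cube.  Only the values of f on
   the closed cube matter. *)
Fixpoint Cclosed c L (k : nat) f : Prop :=
  {within closed_cube c L, continuous f} /\
  if k is k'.+1 then
    forall i : 'I_d, (forall x, cube c L x -> derivable f x (delta_mx 0 i)) /\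
      exists2 g, Cclosed c L k' g & forall x, cube c L x -> partial i f x = g x
  else True.

(* For a quantity that is given by its formula in the open cube only. *)
Definition extends_Cclosed c L (k : nat) f : Prop :=
  exists2 g, Cclosed c L k g & forall x, cube c L x -> f x = g x.

End cube.

Section calculus.
Context {R : realType} {d : nat}.
Local Notation scalar_field := ('rV[R]_d -> R).
Local Notation vector_field := ('rV[R]_d -> 'rV[R]_d).
Local Notation tensor_field := ('rV[R]_d -> 'M[R]_d).
Implicit Types (x : 'rV[R]_d) (K : scalar_field) (v : vector_field).
Implicit Types (H Q tau : tensor_field).

Definition sym_tracefree (A : 'M[R]_d) : Prop := A^T = A /\ \tr A = 0.

Definition frob (A B : 'M[R]_d) : R := \tr (A^T *m B).

Definition grad (f : scalar_field) : vector_field :=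
  fun x => \row_k partial k f x.

Definition gradv v : tensor_field :=
  fun x => \matrix_(i, j) partial j (fun y => v y 0 i) x.

Definition strain v : tensor_field :=
  fun x => 2^-1 *: (gradv v x + (gradv v x)^T).

Definition vorticity v : tensor_field :=
  fun x => 2^-1 *: (gradv v x - (gradv v x)^T).

Definition divv v : scalar_field :=
  fun x => \sum_k partial k (fun y => v y 0 k) x.

Definition divt tau : vector_field :=
  fun x => \row_i \sum_j partial j (fun y => tau y i j) x.

Definition divKgrad K Q : tensor_field :=
  fun x => \matrix_(i, j)
    \sum_k partial k (fun y => K y * partial k (fun z => Q z i j) y) x.

Definition advect_vec v (u : vector_field) : vector_field :=
  fun x => \row_i \sum_k v x 0 k * partial k (fun y => u y 0 i) x.

Definition advect_tensor v Q : tensor_field :=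
  fun x => \matrix_(i, j) \sum_k v x 0 k * partial k (fun y => Q y i j) x.

Definition contract_grad H Q : vector_field :=
  fun x => \row_k \sum_i \sum_j H x i j * partial k (fun y => Q y i j) x.

Definition sqnorm_grad Q : scalar_field :=
  fun x => \sum_i \sum_j \sum_k (partial k (fun y => Q y i j) x) ^+ 2.

Definition dotv (u w : 'rV[R]_d) : R := \sum_i u 0 i * w 0 i.

End calculus.

Section bulk.
Context {R : realType} {d : nat}.
Implicit Types (alpha beta gamma : R) (Q U V W : 'M[R]_d).

Definition f_bulk alpha beta gamma Q : 'M[R]_d :=
  alpha *: Q
  - beta *: (Q *m Q - (\tr (Q *m Q) / d%:R)%:M)
  + (gamma * \tr (Q *m Q)) *: Q.

Definition F_bulk_polarized_density alpha beta gamma U V : R :=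
  alpha / 2 * ((\tr (U *m U) + \tr (V *m V)) / 2)
  - beta / 3 * \tr (U *m V *m (2^-1 *: (U + V)))
  + gamma / 4 * \tr (U *m U) * \tr (V *m V).

Definition f_bulk_polarized alpha beta gamma U V W : 'M[R]_d :=
  let M := 2^-1 *: (U + W) in
  (alpha / 2) *: M
  - (beta / 6) *: (V *m V + V *m M + M *m V
                   - (d%:R^-1 * \tr (V *m (U + V + W)))%:M)
  + (gamma / 2 * \tr (V *m V)) *: M.

End bulk.

Record sge_params (R : realType) (d : nat) := SGEParams {
  corner : 'rV[R]_d;
  side : R;
  phi : 'rV[R]_d -> R;
  Qstar : 'rV[R]_d -> 'M[R]_d;
  b_solid : R;
  eta_fluid : R;
  eta_solid : R;
  xi_fluid : R;
  chi_fluid : R;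
  K_fluid : R;
  Gamma_fluid : R;
  Gamma_solid : R;
  W_0 : R;
  N_fluid : R;
  N_solid : R;
  bulkA : R;  (* A *)
  align : R   (* a *) }.

Section scheme.
Context {R : realType} {d : nat} (P : sge_params R d).
Local Notation scalar_field := ('rV[R]_d -> R).
Local Notation vector_field := ('rV[R]_d -> 'rV[R]_d).
Local Notation tensor_field := ('rV[R]_d -> 'M[R]_d).
Implicit Types (x : 'rV[R]_d).

Definition Omega : set 'rV[R]_d := cube (corner P) (side P).
Definition closed_Omega : set 'rV[R]_d := closed_cube (corner P) (side P).
Definition bnd_Omega : set 'rV[R]_d := cube_boundary (corner P) (side P).
Definition integral_Omega (f : scalar_field) : R :=
  cube_integral (corner P) (side P) f.

Definition b_coef x : R := b_solid P * (1 - phi P x).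
Definition eta_coef x : R := eta_fluid P * phi P x + eta_solid P * (1 - phi P x).
Definition xi_coef x : R := xi_fluid P * phi P x.
Definition chi_coef x : R := chi_fluid P * phi P x.
Definition K_coef x : R := K_fluid P * phi P x.
Definition Gamma_Q x : R :=
  Gamma_fluid P * phi P x + Gamma_solid P * (1 - phi P x).
Definition W_coef x : R :=
  W_0 P * Num.sqrt (dotv (grad (phi P) x) (grad (phi P) x)).
Definition N_coef x : R := N_fluid P * phi P x + N_solid P * (1 - phi P x).
Definition alpha_coef x : R := bulkA P * (1 - N_coef x / 3).
Definition beta_coef x : R := bulkA P * N_coef x.
Definition gamma_coef x : R := bulkA P * N_coef x.

Definition scalar_of_class k (f : scalar_field) : Prop :=
  Cclosed (corner P) (side P) k f.
Definition vector_of_class k (u : vector_field) : Prop :=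
  forall i, scalar_of_class k (fun x => u x 0 i).
Definition tensor_of_class k (T : tensor_field) : Prop :=
  forall i j, scalar_of_class k (fun x => T x i j).
Definition tensor_extends_to_class k (T : tensor_field) : Prop :=
  forall i j, extends_Cclosed (corner P) (side P) k (fun x => T x i j).

Record sge_params_ok : Prop := {
  side_gt0 : 0 < side P;
  phi_class : scalar_of_class 1 (phi P);
  phi_01 : forall x, closed_Omega x -> 0 <= phi P x <= 1;
  Qstar_class : tensor_of_class 0 (Qstar P);
  Qstar_M0 : forall x, Omega x -> sym_tracefree (Qstar P x);
  bulkA_gt0 : 0 < bulkA P;
  b_coef_ge0 : forall x, Omega x -> 0 <= b_coef x;
  eta_ge0 : forall x, Omega x -> 0 <= eta_coef x;
  K_coef_ge0 : forall x, Omega x -> 0 <= K_coef x;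
  Gamma_Q_ge0 : forall x, Omega x -> 0 <= Gamma_Q x;
  W_coef_ge0 : forall x, Omega x -> 0 <= W_coef x;
  N_coef_ge0 : forall x, Omega x -> 0 <= N_coef x }.

Definition innerv (u w : vector_field) : R :=
  integral_Omega (fun x => dotv (u x) (w x)).
Definition innert (S T : tensor_field) : R :=
  integral_Omega (fun x => frob (S x) (T x)).
Definition normv (u : vector_field) : R := Num.sqrt (innerv u u).
Definition normt (T : tensor_field) : R := Num.sqrt (innert T T).

Definition bar (V : lmodType R) (u : nat -> 'rV[R]_d -> V) (n : nat) :
    'rV[R]_d -> V :=
  fun x => 2^-1 *: (u n.+1 x + u n.-1 x).

Definition mol_field (Q : tensor_field) : tensor_field := fun x =>
  divKgrad K_coef Q x
  - f_bulk (alpha_coef x) (beta_coef x) (gamma_coef x) (Q x)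
  - W_coef x *: (Q x - Qstar P x).

Definition Sigma_stress (Q : tensor_field) : tensor_field := fun x =>
  let a := align P in let q := Q x in let h := mol_field Q x in
  q *m h - h *m q - a *: (q *m h + h *m q) - (2 * a / d%:R) *: h
  + (2 * a * frob q h) *: (q + (d%:R^-1)%:M).

Definition S_term (v : vector_field) (Q : tensor_field) : tensor_field := fun x =>
  let a := align P in let q := Q x in
  let D := strain v x in let Om := vorticity v x in
  Om *m q - q *m Om + a *: (q *m D + D *m q) + (2 * a / d%:R) *: D
  - (2 * a * frob D q) *: (q + (d%:R^-1)%:M).

Definition g_v (v : vector_field) : vector_field := v.
Definition G_Q (Q : tensor_field) : tensor_field := fun x => - mol_field Q x.
Definition c_v (v : vector_field) (Q : tensor_field) : vector_field := fun x =>
  - advect_vec v v x + divt (Sigma_stress Q) x - contract_grad (mol_field Q) Q x.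
Definition C_Q (v : vector_field) (Q : tensor_field) : tensor_field := fun x =>
  - advect_tensor v Q x + S_term v Q x.
Definition f_v (Q : tensor_field) : vector_field := fun x =>
  - divt (fun y => chi_coef y *: Q y) x.
Definition F_Q (Q : tensor_field) : tensor_field := fun x => xi_coef x *: Q x.

Definition calG (g : vector_field) (G : tensor_field) : R :=
  normv g ^+ 2 + normt G ^+ 2.

Section unknowns.
Context (Nt : nat) (tau kappa : R).
Context (v : nat -> vector_field) (Q : nat -> tensor_field).

Definition H_bar (n : nat) : tensor_field := fun x =>
  divKgrad K_coef (bar Q n) x
  - W_coef x *: (bar Q n x - Qstar P x)
  - kappa *: (bar Q n x - Q n x)
  - 2 *: f_bulk_polarized (alpha_coef x) (beta_coef x) (gamma_coef x)
           (Q n.-1 x) (Q n x) (Q n.+1 x).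

Definition g_v_bar (n : nat) : vector_field := bar v n.
Definition G_Q_bar (n : nat) : tensor_field := fun x => - H_bar n x.

Definition zero_neumann (T : tensor_field) : Prop :=
  forall x nu, outward_normal (corner P) (side P) x nu -> forall i j,
    h^-1 * (T x i j - T (x - h *: nu) i j) @[h --> 0^'+] --> (0 : R).

Definition Q_boundary_condition : Prop :=
  (exists2 Q_D : tensor_field,
     forall x, bnd_Omega x -> sym_tracefree (Q_D x) &
     forall n, (n <= Nt)%N -> forall x, bnd_Omega x -> Q n x = Q_D x) \/
  (forall n, (n <= Nt)%N -> zero_neumann (Q n)).

(* p n stands for the pressure at the averaged time level, which is an unknown
   of step n, not an average of other unknowns. *)
Record sge_pdg_step (p : nat -> scalar_field) (zeta omega : nat -> R)
    (n : nat) : Prop := {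
  calG_neq0 : calG (g_v (v n)) (G_Q (Q n)) != 0;
  momentum : forall x, Omega x ->
    (2 * tau)^-1 *: (v n.+1 x - v n.-1 x) =
    - grad (p n) x + 2 *: divt (fun y => eta_coef y *: strain (bar v n) y) x
    - b_coef x *: bar v n x + zeta n *: c_v (v n) (Q n) x
    - omega n *: g_v (v n) x + f_v (Q n) x;
  incompressible : forall x, Omega x -> divv (bar v n) x = 0;
  Q_evolution : forall x, Omega x ->
    (2 * tau)^-1 *: (Q n.+1 x - Q n.-1 x) =
    Gamma_Q x *: H_bar n x + zeta n *: C_Q (v n) (Q n) x
    - omega n *: G_Q (Q n) x + F_Q (Q n) x;
  zeta_def : zeta n =
    (innerv (g_v_bar n) (g_v (v n)) + innert (G_Q_bar n) (G_Q (Q n)))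
    / calG (g_v (v n)) (G_Q (Q n));
  omega_def : omega n =
    (innerv (g_v_bar n) (c_v (v n) (Q n)) +
     innert (G_Q_bar n) (C_Q (v n) (Q n)))
    / calG (g_v (v n)) (G_Q (Q n)) }.

(* "Regular enough": every differential expression of the scheme exists
   classically in Omega and is continuous up to the boundary.  Sigma^n gets its
   own clause since div Sigma^n involves derivatives of W and third derivatives
   of Q^n that C^1 / C^2 regularity of phi and Q^n does not provide. *)
Record sge_pdg_regular (p : nat -> scalar_field) : Prop := {
  v_class : forall n, (n <= Nt)%N -> vector_of_class 2 (v n);
  Q_class : forall n, (n <= Nt)%N -> tensor_of_class 2 (Q n);
  p_class : forall n, (1 <= n < Nt)%N -> scalar_of_class 1 (p n);
  Sigma_class : forall n, (1 <= n < Nt)%N ->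
    tensor_extends_to_class 1 (Sigma_stress (Q n)) }.

Record sge_pdg_solution (p : nat -> scalar_field) (zeta omega : nat -> R) :
    Prop := {
  solution_regular : sge_pdg_regular p;
  div_v0 : forall x, Omega x -> divv (v 0) x = 0;
  div_v1 : forall x, Omega x -> divv (v 1) x = 0;
  Q_M0 : forall n, (n <= Nt)%N -> forall x, Omega x -> sym_tracefree (Q n x);
  v_boundary : forall n, (n <= Nt)%N -> forall x, bnd_Omega x -> v n x = 0;
  Q_boundary : Q_boundary_condition;
  solution_step : forall n, (1 <= n < Nt)%N -> sge_pdg_step p zeta omega n }.

Definition F_bulk_polarized (U V : tensor_field) : R :=
  integral_Omega (fun x =>
    F_bulk_polarized_density (alpha_coef x) (beta_coef x) (gamma_coef x) (U x) (V x)).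

(* For n >= 1. *)
Definition E_PDG (n : nat) : R :=
  integral_Omega (fun x =>
    2^-1 * ((dotv (v n.-1 x) (v n.-1 x) + dotv (v n x) (v n x)) / 2)
    + K_coef x / 2 * ((sqnorm_grad (Q n.-1) x + sqnorm_grad (Q n) x) / 2)
    + W_coef x / 2 *
        ((frob (Q n.-1 x - Qstar P x) (Q n.-1 x - Qstar P x) +
          frob (Q n x - Qstar P x) (Q n x - Qstar P x)) / 2)
    + kappa / 4 * frob (Q n x - Q n.-1 x) (Q n x - Q n.-1 x))
  + F_bulk_polarized (Q n.-1) (Q n).

End unknowns.
End scheme.

(* Main.v *)
Require Import Defs.
From HB Require Import structures.
From mathcomp Require Import all_boot all_order all_algebra.
From mathcomp Require Import all_classical all_reals all_analysis.
From mathcomp Require Import measurable_realfun ring lra.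

(* The energy difference is a sum of discrete chain rules: for each quadratic
   term, |a|^2 - |b|^2 = (a - b) : (a + b), and the polarized bulk energy
   telescopes against its polarized discrete gradient.  Hence, with
   dv = v^{n+1} - v^{n-1} and dQ = Q^{n+1} - Q^{n-1}, the difference of the energy
   densities is (dv . vbar - dQ : Hbar) / 2 up to the divergence of K dQ : grad Qbar.
   Inserting the scheme, the zeta and omega terms cancel after integration because
   of the very definition of these scalars, and what is left is the dissipation,
   the active work, and divergences whose fluxes vanish on the boundary.

   The divergence theorem on the cube is Fubini for the tuple measure together with
   the fundamental theorem of calculus on each segment parallel to an axis.  For
   the Neumann condition, the one-sided difference quotient of Q at a face tends to
   the boundary value of the continuous extension of the normal derivative, which
   therefore vanishes there. *)

Set Implicit Arguments.
Unset Strict Implicit.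
Unset Printing Implicit Defensive.

Import Order.TTheory GRing.Theory Num.Theory.
Import numFieldNormedType.Exports.

Local Open Scope classical_set_scope.
Local Open Scope ring_scope.

(** * Lebesgue measure on tuples *)

Section tuple_integral.
Context {R : realType}.
Local Notation T := (measurableTypeR R).

(** A set of finite measure that will contain the support of every integrand. One bound [B] for all
    coordinates makes its preimage under [cons_pair] a product with a box of the same kind, which
    suits induction on [n]. *)
Definition tuple_box n (B : R) : set (n.-tuple T) :=
  [set t | forall i, `|tnth t i : R| <= B].

Arguments tuple_box : clear implicits.

Lemma measurable_tuple_forall n (A : 'I_n -> set T) :
  (forall i, measurable (A i)) ->
  measurable [set t : n.-tuple T | forall i, A i (tnth t i)].
Proof.
move=> mA; rewrite (_ : [set t | _] =
  \bigcap_(i in [set: 'I_n]) ((fun t : n.-tuple T => tnth t i) @^-1` A i)).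
  apply: fin_bigcap_measurable; first exact: finite_finset.
  by move=> i _; rewrite -[X in measurable X]setTI; exact: measurable_tnth.
by apply/seteqP; split=> [t tA i _|t tA i] /=; exact: tA.
Qed.

Lemma measurable_tuple_box n B : measurable (tuple_box n B).
Proof.
apply: (@measurable_tuple_forall n (fun=> [set x : T | `|x : R| <= B])) => _.
rewrite (_ : [set x : T | _] = `[(- B), B]%classic); first exact: measurable_itv.
by apply/seteqP; split=> x /=; rewrite in_itv/= ler_norml.
Qed.

Lemma cons_pair_box n B :
  @cons_pair R n @^-1` tuple_box n.+1 B = `[(- B), B]%classic `*` tuple_box n B.
Proof.
apply/seteqP; split=> [[x t] /= Bxt|[x t] /= [xB tB] i].
  split=> [|i /=]; first by rewrite /= in_itv/= -ler_norml; exact: (Bxt ord0).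
  by have := Bxt (lift ord0 i); rewrite /cons_pair tnthS.
case: (unliftP ord0 i) => [j ->|->]; first by rewrite /cons_pair tnthS; exact: tB.
by move: xB; rewrite /cons_pair tnth0 ler_norml in_itv.
Qed.

Lemma lebesgue_tuple_box_lty n B :
  (lebesgue_tuple R n (tuple_box n B) < +oo)%E.
Proof.
elim: n => [|n IHn] /=; first by rewrite diracE ltry.
rewrite /lebesgue_cons /pushforward cons_pair_box.
rewrite [ltLHS]product_measure1E//; last exact: measurable_tuple_box.
apply: lte_mul_pinfty => //; rewrite ge0_fin_numE//.
rewrite [ltLHS](lebesgue_measure_itv `[(- B), B])/=.
case: ifPn => _; last by rewrite ltry.
by rewrite -EFinD ltry.
Qed.

Definition tuple_upd n (k : 'I_n) (t : n.-tuple T) (x : T) : n.-tuple T :=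
  [tuple if i == k then x else tnth t i | i < n].

Lemma tuple_upd0 n (t : n.-tuple T) x y :
  tuple_upd ord0 (cons_pair (x, t)) y = cons_pair (y, t).
Proof.
apply: eq_from_tnth => i; rewrite tnth_mktuple.
by case: (unliftP ord0 i) => [j ->|->]; rewrite /cons_pair ?tnth0// !tnthS.
Qed.

Lemma tuple_updS n (k : 'I_n) (t : n.-tuple T) x y :
  tuple_upd (lift ord0 k) (cons_pair (x, t)) y = cons_pair (x, tuple_upd k t y).
Proof.
apply: eq_from_tnth => i; rewrite tnth_mktuple.
case: (unliftP ord0 i) => [j ->|->]; rewrite /cons_pair ?tnth0//.
by rewrite !tnthS (inj_eq lift_inj) tnth_mktuple.
Qed.

Lemma measurable_cons_pair n : measurable_fun setT (@cons_pair R n).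
Proof. exact: measurable_cons. Qed.

(** A bounded measurable function is integrable on a set of finite measure, and [F] is the extension
    by zero of its restriction to the box. *)
Lemma integrable_lebesgue_tuple n (F : n.-tuple T -> R) (M B : R) :
  measurable_fun setT F -> (forall t, `|F t| <= M) ->
  (forall t, ~ tuple_box n B t -> F t = 0) ->
  (lebesgue_tuple R n).-integrable setT (EFin \o F).
Proof.
move=> mF bF sF; have mB := @measurable_tuple_box n B.
have -> : EFin \o F = (EFin \o F) \_ (tuple_box n B).
  apply/funext => t; rewrite patchE; case: ifPn => // /negP tB /=.
  by rewrite sF// => tB'; apply: tB; rewrite inE.
apply/(integrable_mkcond _ mB)/measurable_bounded_integrable => //.
- exact: lebesgue_tuple_box_lty.
- exact: measurable_funTS.
- exists M; split; first exact: num_real.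
  by move=> y My t _; exact: le_trans (bF t) (ltW My).
Qed.

(** Fubini, with the order of integration chosen by [k]. If [k] is the head, the inner integral runs
    along the head and vanishes by hypothesis. Otherwise the head is frozen, the inner integral runs
    over the tail, and the induction hypothesis applies to it. *)
Lemma integral_lebesgue_tuple_eq0 n (k : 'I_n) (F : n.-tuple T -> R) (M B : R) :
  measurable_fun setT F -> (forall t, `|F t| <= M) ->
  (forall t, ~ tuple_box n B t -> F t = 0) ->
  (forall t, \int[@lebesgue_measure R]_x (F (tuple_upd k t x))%:E = 0)%E ->
  (\int[lebesgue_tuple R n]_t (F t)%:E = 0)%E.
Proof.
elim: n k F => [[]//|n IHn] k F mF bF sF F0.
have mFc : measurable_fun setT (EFin \o F \o @cons_pair R n).
  apply: (measurableT_comp (f := EFin \o F)); last exact: measurable_cons_pair.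
  exact/measurable_EFinP.
pose lam : {sigma_finite_measure set T -> \bar R} := @lebesgue_measure R.
(* Fubini requires integrability for the product measure; it is transported back from the image
   measure along [cons_pair]. *)
have iF : (lam \x lebesgue_tuple R n)%E.-integrable setT
    (EFin \o F \o @cons_pair R n).
  have /integrableP[_] := integrable_lebesgue_tuple mF bF sF.
  rewrite /= ge0_integral_pushforward//; last 2 first.
  - exact: measurable_cons_pair.
  - by apply/measurable_EFinP; exact: measurableT_comp.
  by rewrite preimage_setT => Foo; apply/integrableP.
rewrite [LHS](integral_pushforward (@measurable_cons_pair n)
  (mu := lam \x lebesgue_tuple R n)%E)//=; last exact/measurable_EFinP.
rewrite preimage_setT.
case: (unliftP ord0 k) => [j kj|k0].
  rewrite -integral12_prod_meas1//; apply: integral0_eq => x _.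
  rewrite /fubini_F/=; apply: (IHn j (fun t => F (cons_pair (x, t)))) => //.
  - apply: (measurableT_comp mF).
    apply: (measurableT_comp (@measurable_cons_pair n)).
    exact: measurable_pair1.
  - move=> t tB; apply: sF => xtB; apply: tB => i.
    by have := xtB (lift ord0 i); rewrite /cons_pair tnthS.
  - move=> t; rewrite -[RHS](F0 (cons_pair (x, t))).
    by apply: eq_integral => y _; rewrite kj tuple_updS.
rewrite -integral21_prod_meas1//; apply: integral0_eq => t _.
(* The head 0 is an arbitrary placeholder, since the update at [ord0] overwrites it. *)
rewrite /fubini_G/= -[RHS](F0 (cons_pair (0 : R, t))).
by apply: eq_integral => y _; rewrite k0 tuple_upd0.
Qed.

Definition row_of_tuple n (t : n.-tuple T) : 'rV[R]_n := \row_i tnth t i.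

(** Links the topology of row vectors with the product sigma-algebra on tuples: an open set is the
    union of the countably many cubes with rational centre and rational radius that it contains. *)
Lemma measurable_row_preimage_open n (U : set 'rV[R]_n) : open U ->
  measurable (@row_of_tuple n @^-1` U).
Proof.
move=> oU; pose I := (n.-tuple rat * rat)%type.
pose C (q : I) : set (n.-tuple T) :=
  [set t | forall i, `|(tnth t i : R) - ratr (tnth q.1 i)| < ratr q.2].
have -> : @row_of_tuple n @^-1` U =
    \bigcup_(q in [set q | C q `<=` @row_of_tuple n @^-1` U]) C q.
  apply/seteqP; split=> [t Ut|t [q /= qU tq]]; last exact: qU.
  have /nbhs_ballP[e /= e0 eU] : nbhs (row_of_tuple t) U by exact: open_nbhs_nbhs.
  (* Two points of a cube of radius [r] differ by less than twice [r] in each coordinate, hence the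
     bound [e / 2]. *)
  have [r /andP[r0 re]] : exists r : rat, (0 < (ratr r : R)) && (ratr r < e / 2).
    have [r] := rat_in_itvoo (divr_gt0 e0 (ltr0Sn R 1)).
    by rewrite in_itv/=; exists r.
  have P i : exists q : rat, `|(tnth t i : R) - ratr q| < ratr r.
    have : tnth t i - ratr r < tnth t i + ratr r :> R.
      by rewrite ltrD2l (lt_trans _ r0)// oppr_lt0.
    move=> /rat_in_itvoo[q]; rewrite in_itv/= => /andP[q1 q2]; exists q.
    by rewrite ltr_distl; apply/andP; split; lra.
  pose s := [tuple sval (cid (P i)) | i < n].
  have Cst : C (s, r) t by move=> i /=; rewrite tnth_mktuple; case: cid.
  exists (s, r) => //= u Cu; apply: eU; split=> // i j.
  rewrite !mxE /ball/=; have := Cu j; have := Cst j => /=.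
  move: (tnth t j : R) (tnth u j : R) (ratr (tnth s j) : R) (ratr r : R) re.
  move=> a b c d de; rewrite !ltr_norml => /andP[? ?] /andP[? ?].
  by apply/andP; split; lra.
rewrite bigcup_mkcond.
apply: countable_bigcupT_measurable => [|q]; first exact: countableP.
case: ifPn => // _; apply: (@measurable_tuple_forall n (fun i =>
  [set x : T | `|(x : R) - ratr (tnth q.1 i)| < ratr q.2])) => i.
rewrite (_ : [set x : T | _] = `](ratr (tnth q.1 i) - ratr q.2),
    (ratr (tnth q.1 i) + ratr q.2)[%classic); first exact: measurable_itv.
by apply/seteqP; split=> x /=; rewrite in_itv/= ltr_distl.
Qed.

End tuple_integral.

Arguments tuple_box {R} n B.

(** * Fields that are regular up to the boundary of the cube *)

Section regular_fields.
Context {R : realType} {d : nat} (c : 'rV[R]_d) (L : R).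
Implicit Types (f g h : 'rV[R]_d -> R) (x y : 'rV[R]_d) (k : 'I_d).

Lemma cube_closed x : cube c L x -> closed_cube c L x.
Proof. by move=> cx i; have /andP[/ltW -> /ltW] := cx i. Qed.

Lemma open_cube : open (cube c L).
Proof.
rewrite openE => x cx; rewrite /interior.
suff: \forall y \near x, forall i, c 0 i < (y : 'rV[R]_d) 0 i < c 0 i + L by [].
apply: (@filter_forall _ 'I_d
  (fun i (y : 'rV[R]_d) => is_true (c 0 i < y 0 i < c 0 i + L))
  (nbhs x) (nbhs_filter x)) => i.
have cxi : nbhs (x 0 i) [set z | c 0 i < z < c 0 i + L].
  have := cx i; rewrite -[_ && _]/(x 0 i \in `]c 0 i, (c 0 i + L)[) => xi.
  by have := near_in_itvoo xi; apply: filterS => y; rewrite in_itv.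
exact: (@coord_continuous R 1 d 0 i x _ cxi).
Qed.

Lemma near_cube x : cube c L x -> \forall y \near x, cube c L y.
Proof. by move=> cx; exact: (open_nbhs_nbhs (conj open_cube cx)). Qed.

Lemma near_eq_cube f g x : (forall y, cube c L y -> f y = g y) ->
  cube c L x -> \forall y \near x, f y = g y.
Proof. by move=> fg /near_cube; apply: filterS. Qed.

Lemma within_cube_continuous f : {within closed_cube c L, continuous f} ->
  forall x, cube c L x -> {for x, continuous f}.
Proof.
move=> cf x cx; have : {within cube c L, continuous f}.
  by apply: continuous_subspaceW cf; exact: cube_closed.
rewrite continuous_open_subspace; last exact: open_cube.
by apply; rewrite inE.
Qed.

(* Regularity in the open cube, insensitive to the values elsewhere. *)
Fixpoint regular (n : nat) f : Prop :=
  extends_Cclosed c L 0 f /\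
  if n is n'.+1 then
    forall i : 'I_d, (forall x, cube c L x -> derivable f x (delta_mx 0 i)) /\
      regular n' (partial i f)
  else True.

(** Derivatives at a point of the open cube depend only on nearby values, and the open cube is a
    neighbourhood of each of its points. *)
Lemma eq_regular n f g : (forall x, cube c L x -> f x = g x) ->
  regular n f -> regular n g.
Proof.
elim: n f g => [|n IHn] f g fg /= [[h h0 hf] H].
  by split=> //; exists h => // x cx; rewrite -fg ?hf.
split; first by exists h => // x cx; rewrite -fg ?hf.
move=> i; have [df rf] := H i; split=> [x cx|].
  by apply: near_eq_derivable (df x cx); exact: near_eq_cube.
apply: IHn rf => x cx.
by apply: near_eq_derive; exact: near_eq_cube.
Qed.

Lemma Cclosed_regular n f : Cclosed c L n f -> regular n f.
Proof.
elim: n f => [|n IHn] f /= [cf H]; first by split=> //; exists f.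
split; first by exists f.
move=> i; have [df [g /IHn rg fg]] := H i; split=> //.
by apply: eq_regular rg => x cx; rewrite fg.
Qed.

Lemma extends_Cclosed_regular n f : extends_Cclosed c L n f -> regular n f.
Proof.
move=> [g /Cclosed_regular rg fg].
by apply: eq_regular rg => x cx; rewrite fg.
Qed.

Lemma regular_extends n f : regular n f -> extends_Cclosed c L 0 f.
Proof. by case: n => [|n] []. Qed.

Lemma regular0 n f : regular n f -> regular 0 f.
Proof. by move=> /regular_extends. Qed.

Lemma regularW n f : regular n.+1 f -> regular n f.
Proof.
elim: n f => [|n IHn] f [f0 H]; first by split.
by split=> // i; have [df rf] := H i; split=> //; exact: IHn.
Qed.

Lemma regular_derivable n f k x : regular n.+1 f -> cube c L x ->
  derivable f x (delta_mx 0 k).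
Proof. by move=> [_ H]; have [+ _] := H k; exact. Qed.
Arguments regular_derivable {n f} k {x} _ _ : rename.

Lemma regular_partial n f k : regular n.+1 f -> regular n (partial k f).
Proof. by move=> [_ H]; have [] := H k. Qed.
Arguments regular_partial {n f} k.

Lemma partialD n f g k x : regular n.+1 f -> regular n.+1 g -> cube c L x ->
  partial k (fun y => f y + g y) x = partial k f x + partial k g x.
Proof.
move=> rf rg cx.
exact: (deriveD (regular_derivable _ rf cx) (regular_derivable _ rg cx)).
Qed.

Lemma partialM n f g k x : regular n.+1 f -> regular n.+1 g -> cube c L x ->
  partial k (fun y => f y * g y) x = f x * partial k g x + g x * partial k f x.
Proof.
move=> rf rg cx.
exact: (deriveM (regular_derivable _ rf cx) (regular_derivable _ rg cx)).
Qed.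

Lemma regular_cst n (a : R) : regular n (fun=> a).
Proof.
elim: n a => [|n IHn] a /=.
  by split=> //; exists (fun=> a) => //; split=> // x; exact: cvg_cst.
split; first by exists (fun=> a) => //; split=> // x; exact: cvg_cst.
move=> i; split=> [x _|]; first exact: derivable_cst.
rewrite (_ : partial i _ = fun=> 0); first exact: IHn.
by apply/funext => x; rewrite /partial derive_cst.
Qed.

Lemma regularD n f g : regular n f -> regular n g ->
  regular n (fun x => f x + g x).
Proof.
elim: n f g => [|n IHn] f g rf rg.
  have [[f' [cf _] ff'] _] := rf; have [[g' [cg _] gg'] _] := rg.
  split=> //; exists (fun x => f' x + g' x).
    by split=> // x; exact: (continuousD (cf x) (cg x)).
  by move=> x cx; rewrite ff'// gg'.
split; first by apply: regular_extends (IHn _ _ (regularW rf) (regularW rg)).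
move=> i; split=> [x cx|].
  exact: (derivableD (regular_derivable _ rf cx) (regular_derivable _ rg cx)).
apply: eq_regular (IHn _ _ (regular_partial i rf) (regular_partial i rg)) => x cx.
by rewrite (partialD _ rf rg).
Qed.

Lemma regularM n f g : regular n f -> regular n g ->
  regular n (fun x => f x * g x).
Proof.
elim: n f g => [|n IHn] f g rf rg.
  have [[f' [cf _] ff'] _] := rf; have [[g' [cg _] gg'] _] := rg.
  split=> //; exists (fun x => f' x * g' x).
    by split=> // x; exact: (continuousM (cf x) (cg x)).
  by move=> x cx; rewrite ff'// gg'.
split; first by apply: regular_extends (IHn _ _ (regularW rf) (regularW rg)).
move=> i; split=> [x cx|].
  exact: (derivableM (regular_derivable _ rf cx) (regular_derivable _ rg cx)).
apply: eq_regular (regularD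
  (IHn _ _ (regularW rf) (regular_partial i rg))
  (IHn _ _ (regularW rg) (regular_partial i rf))) => x cx.
by rewrite (partialM _ rf rg).
Qed.

Lemma regularZ n a f : regular n f -> regular n (fun x => a * f x).
Proof. by move=> rf; exact: regularM (regular_cst n a) rf. Qed.

Lemma regularN n f : regular n f -> regular n (fun x => - f x).
Proof.
by move=> /(regularZ (-1)); apply: eq_regular => x _; rewrite mulN1r.
Qed.

Lemma regularB n f g : regular n f -> regular n g ->
  regular n (fun x => f x - g x).
Proof. by move=> rf rg; apply: regularD => //; exact: regularN. Qed.

Lemma regular_sum n (I : Type) (s : seq I) (p : pred I)
    (F : I -> 'rV[R]_d -> R) :
  (forall i, regular n (F i)) -> regular n (fun x => \sum_(i <- s | p i) F i x).
Proof.
move=> rF; elim: s => [|i s IHs].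
  by apply: eq_regular (regular_cst n 0) => x _; rewrite big_nil.
have [pi|pi] := boolP (p i).
  by apply: eq_regular (regularD (rF i) IHs) => x _; rewrite big_cons pi.
by apply: eq_regular IHs => x _; rewrite big_cons (negbTE pi).
Qed.

(** Confined to order 0 because the square root is not differentiable at 0. It serves for the norm
    of the gradient of [phi] and for the square roots of the coefficients in the dissipation
    terms. *)
Lemma regular_sqrt f : regular 0 f -> regular 0 (fun x => Num.sqrt (f x)).
Proof.
move=> [[g [cg _] fg] _]; split=> //; exists (fun x => Num.sqrt (g x)).
  by split=> // x; exact: (continuous_comp (cg x) (@sqrt_continuous R (g x))).
by move=> x cx; rewrite fg.
Qed.

Lemma partialZ n a f k x : regular n.+1 f -> cube c L x ->
  partial k (fun y => a * f y) x = a * partial k f x.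
Proof.
move=> rf cx; rewrite (partialM _ (regular_cst n.+1 a) rf)//.
by rewrite {2}/partial derive_cst mulr0 addr0.
Qed.

Lemma partialB n f g k x : regular n.+1 f -> regular n.+1 g -> cube c L x ->
  partial k (fun y => f y - g y) x = partial k f x - partial k g x.
Proof.
move=> rf rg cx.
exact: (deriveB (regular_derivable _ rf cx) (regular_derivable _ rg cx)).
Qed.

End regular_fields.

Arguments regular_derivable {R d c L n f} k {x} _ _.

(** * Integration over the cube *)

Section cube_integral_theory.
Context {R : realType} {d : nat} (c : 'rV[R]_d) (L : R).
Local Notation T := (measurableTypeR R).
Implicit Types (f g h : 'rV[R]_d -> R) (x y : 'rV[R]_d) (k : 'I_d).

Definition tuple_cube : set (d.-tuple T) := @row_of_tuple R d @^-1` cube c L.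

Lemma cube_integralE f : cube_integral c L f =
  \int[lebesgue_tuple R d]_(t in tuple_cube) f (row_of_tuple t).
Proof. by []. Qed.

Lemma measurable_tuple_cube : measurable tuple_cube.
Proof. by apply: measurable_row_preimage_open; exact: open_cube. Qed.

Lemma compact_closed_cube : compact (closed_cube c L).
Proof.
rewrite (_ : closed_cube c L =
  [set x | forall i, `[c 0 i, c 0 i + L]%classic (x ord0 i)]).
  apply: (@rV_compact R d (fun i => `[c 0 i, c 0 i + L]%classic)) => i.
  exact: segment_compact.
by apply/seteqP; split=> x cx i; have := cx i; rewrite /= in_itv.
Qed.

Lemma continuous_bounded_cube f : {within closed_cube c L, continuous f} ->
  exists M, forall x, closed_cube c L x -> `|f x| <= M.
Proof.
move=> cf; have := continuous_compact cf compact_closed_cube.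
move=> /compact_bounded[M [_ bM]]; exists (M + 1) => x cx.
have M1 : M < M + 1 by rewrite ltrDl.
by apply: (bM _ M1 (f x)); exists x.
Qed.

(** On the open cube [f] agrees with a function that is continuous up to the boundary, so preimages
    of open intervals are open there; open intervals generate the Borel sets. *)
Lemma measurable_fun_tuple_cube f : regular c L 0 f ->
  measurable_fun tuple_cube (f \o @row_of_tuple R d : _ -> T).
Proof.
move=> [[g [cg _] fg] _].
apply: (eq_measurable_fun (g \o @row_of_tuple R d : _ -> T)).
  by move=> t; rewrite inE => ct /=; rewrite fg.
move=> _; apply: (measurability _ (RGenOpens.measurableE R));
  last exact: measurable_tuple_cube.
move=> _ [_ [a [b ->] <-]].
have -> : tuple_cube `&` (g \o @row_of_tuple R d) @^-1` `]a, b[%classic =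
    @row_of_tuple R d @^-1` (cube c L `&` g @^-1` `]a, b[%classic) by [].
apply: measurable_row_preimage_open; rewrite openE => x [cx gx].
have ngx := within_cube_continuous cg cx.
apply: filterI; first exact: near_cube.
by apply: ngx; apply: open_nbhs_nbhs; split=> //; exact: interval_open.
Qed.

Lemma regular_bounded f : regular c L 0 f ->
  exists M, forall x, cube c L x -> `|f x| <= M.
Proof.
move=> [[g [/continuous_bounded_cube[M gM] _] fg] _]; exists M => x cx.
by rewrite fg// gM//; exact: cube_closed.
Qed.

Lemma tuple_cube_box : exists B, tuple_cube `<=` @tuple_box R d B.
Proof.
(* The summands are nonnegative, so their sum bounds all coordinates at once. *)
exists (\sum_i (`|c 0 i| + `|L|)) => t ct i.
have := ct i; rewrite mxE => /andP[/ltW c1 /ltW c2].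
apply: (@le_trans _ _ (`|c 0 i| + `|L|)).
  have := ler_norm (c 0 i); have := ler_norm L.
  have := ler_norm (- c 0 i); have := ler_norm (- L); rewrite !normrN.
  by move=> ? ? ? ?; rewrite ler_norml; apply/andP; split; lra.
by rewrite (bigD1 i)//= lerDl sumr_ge0// => j _; exact: addr_ge0.
Qed.

(** Gathers, for the extension by zero, the three properties that the integration lemmas on tuples
    ask for: measurability, boundedness, and support in a box. *)
Lemma restrict_tuple_cube f : regular c L 0 f ->
  exists M B,
    [/\ measurable_fun setT ((f \o @row_of_tuple R d) \_ tuple_cube : _ -> T),
        forall t, `|((f \o @row_of_tuple R d) \_ tuple_cube) t| <= M &
        forall t, ~ tuple_box d B t ->
          ((f \o @row_of_tuple R d) \_ tuple_cube) t = 0].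
Proof.
move=> rf; have [M fM] := regular_bounded rf; have [B cB] := tuple_cube_box.
exists `|M|, B; split.
- apply/(measurable_restrictT _ measurable_tuple_cube).
  exact: measurable_fun_tuple_cube.
- move=> t; rewrite patchE; case: ifPn => [|_]; last by rewrite normr0.
  by rewrite inE => ct; rewrite (le_trans (fM _ ct))// ler_norm.
- move=> t tB; rewrite patchE; case: ifPn => //.
  by rewrite inE => /cB.
Qed.

Lemma integrable_tuple_cube f : regular c L 0 f ->
  (lebesgue_tuple R d).-integrable tuple_cube (EFin \o (f \o @row_of_tuple R d)).
Proof.
move=> rf; apply/(integrable_mkcond _ measurable_tuple_cube).
rewrite restrict_EFin; have [M [B [mf fM fB]]] := restrict_tuple_cube rf.
exact: integrable_lebesgue_tuple mf fM fB.
Qed.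

Lemma eq_cube_integral f g : (forall x, cube c L x -> f x = g x) ->
  cube_integral c L f = cube_integral c L g.
Proof. by move=> fg; apply: eq_Rintegral => t; rewrite inE => /fg. Qed.

Lemma cube_integralD f g : regular c L 0 f -> regular c L 0 g ->
  cube_integral c L (fun x => f x + g x) =
  cube_integral c L f + cube_integral c L g.
Proof.
move=> rf rg; rewrite !cube_integralE.
by rewrite -(RintegralD measurable_tuple_cube (integrable_tuple_cube rf)
  (integrable_tuple_cube rg)).
Qed.

Lemma cube_integralZ a f : regular c L 0 f ->
  cube_integral c L (fun x => a * f x) = a * cube_integral c L f.
Proof.
move=> rf; rewrite !cube_integralE.
by rewrite -(RintegralZl a measurable_tuple_cube (integrable_tuple_cube rf)).
Qed.

Lemma cube_integral0 : cube_integral c L (fun=> 0) = 0.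
Proof. by rewrite cube_integralE /Rintegral integral0. Qed.

Lemma cube_integralB f g : regular c L 0 f -> regular c L 0 g ->
  cube_integral c L (fun x => f x - g x) =
  cube_integral c L f - cube_integral c L g.
Proof.
move=> rf rg; rewrite -mulN1r -cube_integralZ// -cube_integralD//; last exact: regularZ.
by apply: eq_cube_integral => x _; rewrite mulN1r.
Qed.

Lemma cube_integral_sum (I : Type) (s : seq I) (F : I -> 'rV[R]_d -> R) :
  (forall i, regular c L 0 (F i)) ->
  cube_integral c L (fun x => \sum_(i <- s) F i x) =
  \sum_(i <- s) cube_integral c L (F i).
Proof.
move=> rF; elim: s => [|i s IHs].
  rewrite big_nil -[RHS]cube_integral0.
  by apply: eq_cube_integral => x _; rewrite big_nil.
rewrite big_cons -IHs -cube_integralD//; last exact: regular_sum.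
by apply: eq_cube_integral => x _; rewrite big_cons.
Qed.

Lemma cube_integral_ge0 f : (forall x, cube c L x -> 0 <= f x) ->
  0 <= cube_integral c L f.
Proof. by move=> f0; apply: Rintegral_ge0 => t; exact: f0. Qed.

End cube_integral_theory.

(** * The divergence theorem on the cube *)

Section divergence.
Context {R : realType} {d : nat} (c : 'rV[R]_d) (L : R).
Local Notation T := (measurableTypeR R).
Implicit Types (f g h : 'rV[R]_d -> R) (x y : 'rV[R]_d) (k : 'I_d).

(** The parameter is the [k]-th coordinate itself, so that a line crossing the cube does so exactly
    over the interval from [c 0 k] to [c 0 k + L]. *)
Definition line y k (s : R) : 'rV[R]_d := y + (s - y 0 k) *: delta_mx 0 k.

Lemma lineE y k s j : line y k s 0 j = if j == k then s else y 0 j.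
Proof.
rewrite !mxE eqxx andTb eq_sym; case: eqP => [<-|_] /=.
  by rewrite mulr1 addrC subrK.
by rewrite mulr0 addr0.
Qed.

Lemma line_id y k : line y k (y 0 k) = y.
Proof. by rewrite /line subrr scale0r addr0. Qed.

Lemma lineD y k s e : line y k (e + s) = e *: delta_mx 0 k + line y k s.
Proof. by rewrite /line -addrA scalerDl addrCA. Qed.

Lemma row_tuple_upd (t : d.-tuple T) k (s : R) :
  row_of_tuple (tuple_upd k t s) = line (row_of_tuple t) k s.
Proof.
apply/rowP => j; rewrite lineE !mxE tnth_mktuple.
by case: eqP => // ->.
Qed.

Lemma continuous_line y k : continuous (line y k).
Proof.
move=> s; apply: cvgD; first exact: cvg_cst.
by apply: cvgZr_tmp; apply: cvgB; [exact: cvg_id|exact: cvg_cst].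
Qed.

(** The [k]-th coordinate is left free: these are the points whose parallel to the axis [k] crosses
    the open cube. On the two faces orthogonal to that axis they form the relative interior, as in
    [outward_normal]. *)
Definition near_face k x :=
  forall j, j != k -> c 0 j < x 0 j < c 0 j + L.

Lemma line_closed_cube y k s : near_face k y ->
  c 0 k <= s <= c 0 k + L -> closed_cube c L (line y k s).
Proof.
move=> ky sk j; rewrite lineE; case: eqP => [->//|/eqP jk].
by have /andP[/ltW -> /ltW] := ky j jk.
Qed.

Lemma line_cube y k s : near_face k y ->
  c 0 k < s < c 0 k + L -> cube c L (line y k s).
Proof.
by move=> ky sk j; rewrite lineE; case: eqP => [->//|/eqP jk]; exact: ky.
Qed.

Lemma continuous_on_line f y k : near_face k y ->
  {within closed_cube c L, continuous f} ->
  {within `[c 0 k, c 0 k + L], continuous (f \o line y k)}.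
Proof.
move=> ky /subspace_continuousP cf; apply/subspace_continuousP => s /= sk.
have /cf : closed_cube c L (line y k s).
  by apply: line_closed_cube => //; move: sk; rewrite in_itv.
move=> cfl; apply: cvg_comp cfl => A; rewrite /within/= => /(@continuous_line y k s).
move=> nA.
suff : \forall u \near s, `[c 0 k, c 0 k + L]%classic u -> A (line y k u) by [].
apply: (@filterS _ (nbhs s) _ _ _ _ nA) => u uA uk; apply: uA.
by apply: line_closed_cube => //; move: uk; rewrite in_itv.
Qed.

Lemma derivable_on_line f y k s : derivable f (line y k s) (delta_mx 0 k) ->
  derivable (f \o line y k) s 1 /\
  derive1 (f \o line y k) s = partial k f (line y k s).
Proof.
have E : (fun e : R => e^-1 *: ((f \o line y k) (e *: 1 + s) - (f \o line y k) s))
    = (fun e => e^-1 *: (f (e *: delta_mx 0 k + line y k s) - f (line y k s))).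
  by apply/funext => e; rewrite /= /GRing.scale/= mulr1 lineD.
by move=> df; rewrite derive1E /derivable /derive /partial /derive E.
Qed.

Definition zero_on_faces k h := forall x, near_face k x ->
  (x 0 k = c 0 k \/ x 0 k = c 0 k + L) -> h x = 0.

Lemma cube_integral_partial_eq0 h k : 0 < L ->
  {within closed_cube c L, continuous h} ->
  (forall x, cube c L x -> derivable h x (delta_mx 0 k)) ->
  regular c L 0 (partial k h) -> zero_on_faces k h ->
  cube_integral c L (partial k h) = 0.
Proof.
move=> L0 ch dh rh h0; have [[g [cg _] hg] _] := rh.
have [M [B [mh hM hB]]] := restrict_tuple_cube rh.
rewrite cube_integralE Rintegral_mkcond /Rintegral.
rewrite (integral_lebesgue_tuple_eq0 (k := k) mh hM hB)// => t.
set y := row_of_tuple t.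
(* A line that misses the cube contributes 0, because the extension by zero vanishes all along
   it. *)
have [ky|ky] := pselect (near_face k y); last first.
  apply: integral0_eq => s _; rewrite patchE; case: ifPn => //.
  rewrite inE /tuple_cube/= row_tuple_upd -/y => cs; exfalso; apply: ky => j jk.
  by have := cs j; rewrite lineE (negbTE jk).
have cgl := continuous_on_line ky cg; have chl := continuous_on_line ky ch.
have ab : c 0 k < c 0 k + L by rewrite ltrDl.
(* Along a line that crosses the cube, the extension by zero is supported in an open segment, where
   the derivative may be replaced by its continuous extension [g]. *)
transitivity (integral (@lebesgue_measure R) `]c 0 k, c 0 k + L[%classic
    (fun s => (g (line y k s))%:E)).
  rewrite [RHS]integral_mkcond; apply: eq_integral => s _.
  rewrite !patchE /tuple_cube.
  case: ifPn => [|/negP cs].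
    rewrite inE/= row_tuple_upd -/y => cs; rewrite ifT; first by rewrite -hg.
    by rewrite inE/= in_itv/=; have := cs k; rewrite lineE eqxx.
  rewrite ifF//; apply/negP; rewrite inE/= in_itv/= => sk.
  by apply: cs; rewrite inE/= row_tuple_upd; exact: line_cube.
have mg : measurable_fun `]c 0 k, c 0 k + L[ (g \o line y k).
  apply: (measurable_funS (measurable_itv `[c 0 k, c 0 k + L])).
    exact: subset_itv_oo_cc.
  by apply: subspace_continuous_measurable_fun => //; exact: measurable_itv.
(* The endpoints have measure zero; adding them gives the closed segment on which the fundamental
   theorem of calculus is stated. *)
rewrite -(integral_itv_bndoo true false); last exact/measurable_EFinP.
rewrite (@continuous_FTC2 _ (g \o line y k) (h \o line y k))//=.
- have kl s : near_face k (line y k s).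
    by move=> j jk; rewrite lineE (negbTE jk); exact: ky.
  rewrite (h0 _ (kl (c 0 k + L))); last by right; rewrite lineE eqxx.
  rewrite (h0 _ (kl (c 0 k))); last by left; rewrite lineE eqxx.
  by rewrite sube0.
- have [_ ha hb] := (continuous_within_itvP _ ab).1 chl.
  split=> // s; rewrite in_itv/= => sk.
  exact: (derivable_on_line (dh _ (line_cube ky sk))).1.
- move=> s; rewrite in_itv/= => sk; have cs := line_cube ky sk.
  by rewrite (derivable_on_line (dh _ cs)).2 hg.
Qed.

(** The product rule reduces this to a single derivative. The function [h] carries the boundary
    values: [f] and [g] may themselves be derivatives, whose values outside the open cube carry no
    information, so their product is replaced by a representative continuous up to the boundary. *)
Lemma cube_integral_by_parts f g h k : 0 < L ->
  regular c L 1 f -> regular c L 1 g ->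
  {within closed_cube c L, continuous h} ->
  (forall x, cube c L x -> h x = f x * g x) -> zero_on_faces k h ->
  cube_integral c L (fun x => f x * partial k g x + g x * partial k f x) = 0.
Proof.
move=> L0 rf rg ch hfg h0.
have rh : regular c L 1 h.
  by apply: eq_regular (regularM rf rg) => x cx; rewrite hfg.
rewrite -(cube_integral_partial_eq0 L0 ch _ _ h0).
- apply: eq_cube_integral => x cx; rewrite -(partialM k rf rg cx).
  by apply/esym; apply: near_eq_derive; apply: (near_eq_cube hfg).
- by move=> x cx; exact: (regular_derivable k rh cx).
- exact: regular_partial.
Qed.

End divergence.

(** * One-sided difference quotients at the ends of a segment *)

Section one_sided_slope.
Context {R : realType}.
Implicit Types (f g : R -> R) (a b : R).

(** By the mean value theorem the quotient equals [g] at a point between [a] and [a + h], and [g] is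
    continuous at [a] from the right. No derivative of [f] at the endpoint is involved. *)
Lemma slope_at_left_end f g a b : a < b ->
  {within `[a, b], continuous f} -> {within `[a, b], continuous g} ->
  (forall s, s \in `]a, b[ -> is_derive s 1 f (g s)) ->
  (fun h => h^-1 * (f (a + h) - f a)) @ 0^'+ --> g a.
Proof.
move=> ab cf cg df; apply/cvgrPdist_lt => e e0.
have [_ ga _] := (continuous_within_itvP _ ab).1 cg.
have /cvgrPdist_lt/(_ _ e0) := ga; rewrite /at_right near_withinE.
move=> /nbhs_ballP[r /= r0 rP]; near=> h.
have h0 : 0 < h by near: h; exact: nbhs_right_gt.
have hr : h < r by near: h; exact: nbhs_right_lt.
have hb : h < b - a by near: h; apply: nbhs_right_lt; rewrite subr_gt0.
have ah : a < a + h by rewrite ltrDl.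
have dh s : s \in `]a, (a + h)[ -> is_derive s 1 f (g s).
  rewrite in_itv/= => /andP[s1 s2]; apply: df; rewrite in_itv/= s1/=.
  by apply: lt_trans s2 _; rewrite -ltrBrDl.
have ch : {within `[a, (a + h)], continuous f}.
  apply: continuous_subspaceW cf => s; rewrite /= !in_itv/= => /andP[-> /=].
  by move=> /le_trans; apply; rewrite -lerBrDl ltW.
have [s] := MVT ah dh ch.
rewrite in_itv/= => /andP[s1 s2] ->.
rewrite addrAC subrr add0r mulrCA mulVf ?gt_eqF// mulr1.
by apply: rP => //; rewrite /ball/= ltr_distlC; apply/andP; split; lra.
Unshelve. all: by end_near. Qed.

Lemma slope_at_right_end f g a b : a < b ->
  {within `[a, b], continuous f} -> {within `[a, b], continuous g} ->
  (forall s, s \in `]a, b[ -> is_derive s 1 f (g s)) ->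
  (fun h => h^-1 * (f b - f (b - h))) @ 0^'+ --> g b.
Proof.
move=> ab cf cg df; apply/cvgrPdist_lt => e e0.
have [_ _ gb] := (continuous_within_itvP _ ab).1 cg.
have /cvgrPdist_lt/(_ _ e0) := gb; rewrite /at_left near_withinE.
move=> /nbhs_ballP[r /= r0 rP]; near=> h.
have h0 : 0 < h by near: h; exact: nbhs_right_gt.
have hr : h < r by near: h; exact: nbhs_right_lt.
have hb : h < b - a by near: h; apply: nbhs_right_lt; rewrite subr_gt0.
have ah : b - h < b by rewrite gtrBl.
have dh s : s \in `](b - h), b[ -> is_derive s 1 f (g s).
  rewrite in_itv/= => /andP[s1 s2]; apply: df; rewrite in_itv/= s2 andbT.
  by apply: lt_trans s1; rewrite ltrBrDl -ltrBrDr.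
have ch : {within `[(b - h), b], continuous f}.
  apply: continuous_subspaceW cf => s; rewrite /= !in_itv/= => /andP[+ ->].
  by rewrite andbT; apply: le_trans; rewrite lerBrDl -lerBrDr ltW.
have [s] := MVT ah dh ch.
rewrite in_itv/= => /andP[s1 s2] ->.
rewrite subKr mulrCA mulVf ?gt_eqF// mulr1.
by apply: rP => //; rewrite /ball/= ltr_distlC; apply/andP; split; lra.
Unshelve. all: by end_near. Qed.

End one_sided_slope.

(** * The homogeneous Neumann condition in terms of extended derivatives *)

Section neumann.
Context {R : realType} {d : nat} (c : 'rV[R]_d) (L : R).
Implicit Types (f g : 'rV[R]_d -> R) (x y : 'rV[R]_d) (k : 'I_d).

Lemma neumann_partial_eq0 f g k : 0 < L ->
  {within closed_cube c L, continuous f} ->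
  (forall x, cube c L x -> derivable f x (delta_mx 0 k)) ->
  {within closed_cube c L, continuous g} ->
  (forall x, cube c L x -> partial k f x = g x) ->
  (forall x nu, outward_normal c L x nu ->
     (fun e : R => e^-1 * (f x - f (x - e *: nu))) @ 0^'+ --> (0 : R)) ->
  zero_on_faces c L k g.
Proof.
move=> L0 cf df cg fg nf x kx xk.
have ab : c 0 k < c 0 k + L by rewrite ltrDl.
have cfl := continuous_on_line kx cf; have cgl := continuous_on_line kx cg.
have dfl s : s \in `]c 0 k, c 0 k + L[ ->
    is_derive s 1 (f \o line x k) ((g \o line x k) s).
  rewrite in_itv/= => sk; have cs := line_cube kx sk.
  have [dl] := derivable_on_line (df _ cs).
  rewrite derive1E fg// => dE; apply: DeriveDef => //.
have lD s e : line x k (s + e) = line x k s + e *: delta_mx 0 k.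
  by rewrite addrC lineD addrC.
case: xk => xk.
(* On the lower face the normal is [- delta_mx 0 k], so the outward quotient is the opposite of the
   slope in the coordinate direction. *)
- have /nf : outward_normal c L x (- delta_mx 0 k) by exists k => //; left.
  have := slope_at_left_end ab cfl cgl dfl; rewrite /= -xk line_id => /cvgN.
  have -> : (- (fun e : R => e^-1 * (f (line x k (x 0 k + e)) - f x))) =
      (fun e : R => e^-1 * (f x - f (x - e *: - delta_mx 0 k))).
    by apply/funext => e; rewrite fctE -mulrN opprB lD line_id scalerN opprK.
  by move=> /[swap] /cvg_unique => /[apply] H; apply: oppr_inj; rewrite oppr0 H.
- have /nf : outward_normal c L x (delta_mx 0 k) by exists k => //; right.
  have := slope_at_right_end ab cfl cgl dfl; rewrite /= -xk line_id.
  have -> : (fun e : R => e^-1 * (f x - f (line x k (x 0 k - e)))) =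
      (fun e : R => e^-1 * (f x - f (x - e *: delta_mx 0 k))).
    by apply/funext => e; rewrite lD line_id scaleNr.
  by move=> s1 s2; exact: (cvg_unique _ s1 s2).
Qed.

End neumann.

(** * Matrix algebra and the polarized bulk energy *)

Section matrix_products.
Context {R : realType} {d : nat}.
Implicit Types (u w : 'rV[R]_d) (A B U V W : 'M[R]_d) (a : R).

Lemma dotvC u w : dotv u w = dotv w u.
Proof. by apply: eq_bigr => i _; rewrite mulrC. Qed.

Lemma dotvDl u1 u2 w : dotv (u1 + u2) w = dotv u1 w + dotv u2 w.
Proof. by rewrite -big_split; apply: eq_bigr => i _; rewrite mxE mulrDl. Qed.

Lemma dotvZl a u w : dotv (a *: u) w = a * dotv u w.
Proof. by rewrite mulr_sumr; apply: eq_bigr => i _; rewrite mxE mulrA. Qed.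

Lemma dotvNl u w : dotv (- u) w = - dotv u w.
Proof. by rewrite -scaleN1r dotvZl mulN1r. Qed.

Lemma dotvDr u w1 w2 : dotv u (w1 + w2) = dotv u w1 + dotv u w2.
Proof. by rewrite dotvC dotvDl !(dotvC u). Qed.

Lemma dotvZr a u w : dotv u (a *: w) = a * dotv u w.
Proof. by rewrite dotvC dotvZl (dotvC u). Qed.

Lemma dotv_ge0 u : 0 <= dotv u u.
Proof. by apply: sumr_ge0 => i _; rewrite -expr2 sqr_ge0. Qed.

Lemma frobE A B : frob A B = \sum_i \sum_j A i j * B i j.
Proof.
rewrite /frob /mxtrace exchange_big; apply: eq_bigr => i _.
by rewrite mxE; apply: eq_bigr => j _; rewrite mxE.
Qed.

Lemma frobC A B : frob A B = frob B A.
Proof. by rewrite /frob -mxtrace_tr trmx_mul trmxK. Qed.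

Lemma frobDr A B1 B2 : frob A (B1 + B2) = frob A B1 + frob A B2.
Proof. by rewrite /frob mulmxDr mxtraceD. Qed.

Lemma frobZr a A B : frob A (a *: B) = a * frob A B.
Proof. by rewrite /frob -scalemxAr mxtraceZ. Qed.

Lemma frobNr A B : frob A (- B) = - frob A B.
Proof. by rewrite -scaleN1r frobZr mulN1r. Qed.

Lemma frobDl A1 A2 B : frob (A1 + A2) B = frob A1 B + frob A2 B.
Proof. by rewrite frobC frobDr !(frobC B). Qed.

Lemma frobZl a A B : frob (a *: A) B = a * frob A B.
Proof. by rewrite frobC frobZr (frobC B). Qed.

Lemma frobNl A B : frob (- A) B = - frob A B.
Proof. by rewrite frobC frobNr (frobC B). Qed.

Lemma frob_ge0 A : 0 <= frob A A.
Proof.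
by rewrite frobE; do 2!(apply: sumr_ge0 => ? _); rewrite -expr2 sqr_ge0.
Qed.

(** A symmetric matrix has the same product with [B] and with its transpose. This is what turns a
    velocity gradient into a strain rate. *)
Lemma frob_sym A B : A^T = A -> frob A (2^-1 *: (B + B^T)) = frob A B.
Proof.
move=> symA; rewrite frobZr frobDr.
have -> : frob A B^T = frob A B.
  by rewrite /frob symA -[LHS]mxtrace_tr trmx_mul trmxK symA mxtrace_mulC.
by field.
Qed.

Lemma frob_strain_grad B :
  frob (2^-1 *: (B + B^T)) B = frob (2^-1 *: (B + B^T)) (2^-1 *: (B + B^T)).
Proof.
by rewrite frob_sym// linearZ/= linearD/= trmxK [B^T + _]addrC.
Qed.

(* The trace part of [f_bulk_polarized] is invisible against the trace-free
   difference [W - U], and the cubic terms agree up to cyclic permutation. *)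
Lemma F_bulk_polarized_diff (al be ga : R) U V W :
  sym_tracefree U -> sym_tracefree W ->
  F_bulk_polarized_density al be ga V W - F_bulk_polarized_density al be ga U V =
  frob (W - U) (f_bulk_polarized al be ga U V W).
Proof.
move=> [symU trU] [symW trW].
have cyc A B C : \tr (A *m B *m C) = \tr (B *m C *m A).
  by rewrite -mulmxA mxtrace_mulC.
have trW_U B : frob (W - U) B = \tr (W *m B) - \tr (U *m B).
  by rewrite /frob linearB/= symU symW mulmxBl linearB.
rewrite /f_bulk_polarized /F_bulk_polarized_density; set s := d%:R^-1 * _.
set M := 2^-1 *: (U + W).
have frobM : frob (W - U) M = 2^-1 * (\tr (W *m W) - \tr (U *m U)).
  rewrite frobZr trW_U !mulmxDr !mxtraceD (mxtrace_mulC W U); ring.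
have frobVM : frob (W - U) (V *m M) = 2^-1 *
    (\tr (W *m V *m U) + \tr (W *m V *m W) - \tr (U *m V *m U) - \tr (U *m V *m W)).
  rewrite -scalemxAr frobZr trW_U !mulmxDr !mxtraceD !mulmxA; ring.
have frobMV : frob (W - U) (M *m V) = 2^-1 *
    (\tr (W *m U *m V) + \tr (W *m W *m V) - \tr (U *m U *m V) - \tr (U *m W *m V)).
  rewrite -scalemxAl frobZr trW_U mulmxDl !mulmxDr !mxtraceD !mulmxA; ring.
have frobs : frob (W - U) s%:M = 0.
  by rewrite trW_U !mul_mx_scalar !mxtraceZ trU trW !mulr0 subrr.
have cubicVW : \tr (V *m W *m (2^-1 *: (V + W))) =
    2^-1 * (\tr (W *m V *m V) + \tr (W *m W *m V)).
  by rewrite -scalemxAr mxtraceZ mulmxDr mxtraceD -(cyc V W V) -(cyc V W W).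
have cubicUV : \tr (U *m V *m (2^-1 *: (U + V))) =
    2^-1 * (\tr (U *m U *m V) + \tr (U *m V *m V)).
  by rewrite -scalemxAr mxtraceZ mulmxDr mxtraceD (cyc U U V) (cyc U V U).
clearbody M; rewrite cubicVW cubicUV !(frobDr, frobNr, frobZr) frobM frobVM frobMV frobs.
(* The triple traces with [V] in the middle are rotated so that [V] stands last; those involving all
   of [U], [V], [W] then cancel between [V *m M] and [M *m V]. *)
rewrite trW_U !mulmxA (cyc W V U) (cyc V U W) (cyc W V W) (cyc V W W).
rewrite (cyc U V U) (cyc V U U) (cyc U V W) (cyc V W U).
by field.
Qed.

End matrix_products.

(** * Vector and tensor fields *)

Section vector_tensor_fields.
Context {R : realType} {d : nat} (c : 'rV[R]_d) (L : R).
Implicit Types (K p : 'rV[R]_d -> R) (u v w : 'rV[R]_d -> 'rV[R]_d).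
Implicit Types (A B S : 'rV[R]_d -> 'M[R]_d).
Local Notation reg := (regular c L).
Local Notation I := (cube_integral c L).

Definition regular_vector n u := forall i, reg n (fun x => u x 0 i).
Definition regular_tensor n A := forall i j, reg n (fun x => A x i j).

Lemma regular_tensorD n A B : regular_tensor n A -> regular_tensor n B ->
  regular_tensor n (fun x => A x + B x).
Proof.
by move=> rA rB i j; apply: eq_regular (regularD (rA i j) (rB i j)) => x _; rewrite mxE.
Qed.

Lemma regular_tensorZ n K A : reg n K -> regular_tensor n A ->
  regular_tensor n (fun x => K x *: A x).
Proof.
by move=> rK rA i j; apply: eq_regular (regularM rK (rA i j)) => x _; rewrite mxE.
Qed.

Lemma regular_tensorN n A : regular_tensor n A -> regular_tensor n (fun x => - A x).
Proof. by move=> rA i j; apply: eq_regular (regularN (rA i j)) => x _; rewrite mxE. Qed.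

Lemma regular_tensorB n A B : regular_tensor n A -> regular_tensor n B ->
  regular_tensor n (fun x => A x - B x).
Proof. by move=> rA rB; apply: regular_tensorD => //; exact: regular_tensorN. Qed.

Lemma regular_tensorM n A B : regular_tensor n A -> regular_tensor n B ->
  regular_tensor n (fun x => A x *m B x).
Proof.
move=> rA rB i j; apply: (@eq_regular _ _ _ _ _
    (fun x => \sum_k A x i k * B x k j)) => [x _|]; first by rewrite mxE.
by apply: regular_sum => k; exact: regularM.
Qed.

Lemma regular_tensor_tr n A : regular_tensor n A ->
  regular_tensor n (fun x => (A x)^T).
Proof. by move=> rA i j; apply: eq_regular (rA j i) => x _; rewrite mxE. Qed.

Lemma regular_scalar_mx n K : reg n K -> regular_tensor n (fun x => (K x)%:M).
Proof.
move=> rK i j; have [ij|ij] := eqVneq i j.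
  by apply: eq_regular rK => x _; rewrite mxE ij eqxx.
by apply: eq_regular (regular_cst c L n 0) => x _; rewrite mxE (negbTE ij).
Qed.

Lemma regular_trace n A : regular_tensor n A -> reg n (fun x => \tr (A x)).
Proof. by move=> rA; apply: regular_sum => i; exact: rA. Qed.

Lemma regular_frob n A B : regular_tensor n A -> regular_tensor n B ->
  reg n (fun x => frob (A x) (B x)).
Proof.
move=> rA rB; apply: regular_trace; apply: regular_tensorM => //.
exact: regular_tensor_tr.
Qed.

Lemma regular_dotv n u w : regular_vector n u -> regular_vector n w ->
  reg n (fun x => dotv (u x) (w x)).
Proof. by move=> ru rw; apply: regular_sum => i; exact: regularM. Qed.

Lemma regular_vectorD n u w : regular_vector n u -> regular_vector n w ->
  regular_vector n (fun x => u x + w x).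
Proof.
by move=> ru rw i; apply: eq_regular (regularD (ru i) (rw i)) => x _; rewrite mxE.
Qed.

Lemma regular_vectorN n u : regular_vector n u -> regular_vector n (fun x => - u x).
Proof. by move=> ru i; apply: eq_regular (regularN (ru i)) => x _; rewrite mxE. Qed.

Lemma regular_gradv n v : regular_vector n.+1 v -> regular_tensor n (gradv v).
Proof.
by move=> rv i j; apply: eq_regular (regular_partial j (rv i)) => x _; rewrite mxE.
Qed.

Lemma regular_strain n v : regular_vector n.+1 v -> regular_tensor n (strain v).
Proof.
move=> rv; apply: regular_tensorZ; first exact: regular_cst.
by apply: regular_tensorD; last apply: regular_tensor_tr; exact: regular_gradv.
Qed.

Lemma regular_vorticity n v : regular_vector n.+1 v -> regular_tensor n (vorticity v).
Proof.
move=> rv; apply: regular_tensorZ; first exact: regular_cst.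
by apply: regular_tensorB; last apply: regular_tensor_tr; exact: regular_gradv.
Qed.

Lemma regular_divv n v : regular_vector n.+1 v -> reg n (divv v).
Proof. by move=> rv; apply: regular_sum => i; exact: regular_partial. Qed.

Lemma regular_grad n p : reg n.+1 p -> regular_vector n (grad p).
Proof.
by move=> rp i; apply: eq_regular (regular_partial i rp) => x _; rewrite mxE.
Qed.

Lemma regular_divt n A : regular_tensor n.+1 A -> regular_vector n (divt A).
Proof.
move=> rA i; apply: (@eq_regular _ _ _ _ _
  (fun x => \sum_j partial j (fun y => A y i j) x)) => [x _|]; first by rewrite mxE.
by apply: regular_sum => j; exact: regular_partial.
Qed.

Lemma regular_divKgrad n K A : reg n.+1 K -> regular_tensor n.+2 A ->
  regular_tensor n (divKgrad K A).
Proof.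
move=> rK rA i j; apply: (@eq_regular _ _ _ _ _ (fun x => \sum_k
  partial k (fun y => K y * partial k (fun z => A z i j) y) x)) => [x _|].
  by rewrite mxE.
apply: regular_sum => k; apply: (regular_partial k); apply: regularM => //.
exact: regular_partial.
Qed.

Lemma regular_advect_vec n v w : regular_vector n v -> regular_vector n.+1 w ->
  regular_vector n (advect_vec v w).
Proof.
move=> rv rw i; apply: (@eq_regular _ _ _ _ _ (fun x => \sum_k
  v x 0 k * partial k (fun y => w y 0 i) x)) => [x _|]; first by rewrite mxE.
by apply: regular_sum => k; apply: regularM => //; exact: regular_partial.
Qed.

Lemma regular_advect_tensor n v A : regular_vector n v -> regular_tensor n.+1 A ->
  regular_tensor n (advect_tensor v A).
Proof.
move=> rv rA i j; apply: (@eq_regular _ _ _ _ _ (fun x => \sum_k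
  v x 0 k * partial k (fun y => A y i j) x)) => [x _|]; first by rewrite mxE.
by apply: regular_sum => k; apply: regularM => //; exact: regular_partial.
Qed.

Lemma regular_contract_grad n A B : regular_tensor n A -> regular_tensor n.+1 B ->
  regular_vector n (contract_grad A B).
Proof.
move=> rA rB k; apply: (@eq_regular _ _ _ _ _ (fun x => \sum_i \sum_j
  A x i j * partial k (fun y => B y i j) x)) => [x _|]; first by rewrite mxE.
apply: regular_sum => i; apply: regular_sum => j; apply: regularM => //.
exact: regular_partial.
Qed.

Lemma regular_sqnorm_grad n A : regular_tensor n.+1 A -> reg n (sqnorm_grad A).
Proof.
move=> rA; do 3!(apply: regular_sum => ?).
by apply: regularM; exact: regular_partial.
Qed.

(** The polarization of [sqnorm_grad]. *)
Definition dot_grad A B : 'rV[R]_d -> R := fun x => \sum_i \sum_j \sum_k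
  partial k (fun y => A y i j) x * partial k (fun y => B y i j) x.

Lemma regular_dot_grad n A B : regular_tensor n.+1 A -> regular_tensor n.+1 B ->
  reg n (dot_grad A B).
Proof.
move=> rA rB; do 3!(apply: regular_sum => ?).
by apply: regularM; exact: regular_partial.
Qed.

Definition zero_on_bnd (f : 'rV[R]_d -> R) := forall x, cube_boundary c L x -> f x = 0.

Hypothesis L0 : 0 < L.

Lemma zero_on_bnd_faces f k : zero_on_bnd f -> zero_on_faces c L k f.
Proof.
move=> f0 x kx xk; apply: f0; split=> [j|cx].
  have [->|jk] := eqVneq j k; last by have /andP[/ltW -> /ltW] := kx j jk.
  by case: xk => ->; rewrite !lexx/= lerDl ltW.
by have := cx k; case: xk => ->; rewrite ltxx ?andbF.
Qed.

(** The factor [f] is continuous on the closed cube and has genuine boundary values; [g] enters the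
    flux only through its continuous extension, which the zeros of [f] annihilate on the faces. *)
Lemma dirichlet_by_parts f g k : {within closed_cube c L, continuous f} ->
  zero_on_faces c L k f -> reg 1 f -> reg 1 g ->
  I (fun x => f x * partial k g x + g x * partial k f x) = 0.
Proof.
move=> cf f0 rf rg; have [g' [cg _] gg'] := regular_extends rg.
apply: (@cube_integral_by_parts _ _ _ _ _ _ (fun x => f x * g' x)) => //.
- by move=> x; exact: (continuousM (cf x) (cg x)).
- by move=> x cx; rewrite gg'.
- by move=> x kx xk; rewrite f0// mul0r.
Qed.

Lemma regular_by_parts f g k : reg 1 f -> reg 1 g ->
  reg 0 (fun x => f x * partial k g x + g x * partial k f x).
Proof.
by move=> rf rg; apply: regularD; apply: regularM;
  do ?[exact: regularW|exact: regular_partial].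
Qed.

Lemma divergence_scalar u p :
  (forall i, {within closed_cube c L, continuous (fun x => u x 0 i)}) ->
  (forall i, zero_on_bnd (fun x => u x 0 i)) ->
  regular_vector 1 u -> reg 1 p ->
  I (fun x => dotv (u x) (grad p x) + p x * divv u x) = 0.
Proof.
move=> cu u0 ru rp; rewrite (@eq_cube_integral _ _ _ _ _ (fun x => \sum_k
  (u x 0 k * partial k p x + p x * partial k (fun y => u y 0 k) x))); last first.
  move=> x cx; rewrite big_split/= mulr_sumr; congr (_ + _).
  by apply: eq_bigr => k _; rewrite mxE.
rewrite cube_integral_sum; last by move=> k; exact: regular_by_parts.
by apply: big1 => k _; apply: dirichlet_by_parts => //; exact: zero_on_bnd_faces.
Qed.

Lemma divergence_tensor u A :
  (forall i, {within closed_cube c L, continuous (fun x => u x 0 i)}) ->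
  (forall i, zero_on_bnd (fun x => u x 0 i)) ->
  regular_vector 1 u -> regular_tensor 1 A ->
  I (fun x => dotv (u x) (divt A x) + frob (A x) (gradv u x)) = 0.
Proof.
move=> cu u0 ru rA; rewrite (@eq_cube_integral _ _ _ _ _ (fun x => \sum_i \sum_j
  (u x 0 i * partial j (fun y => A y i j) x +
   A x i j * partial j (fun y => u y 0 i) x))); last first.
  move=> x cx; rewrite frobE -big_split/=; apply: eq_bigr => i _.
  rewrite mxE mulr_sumr -big_split/=; apply: eq_bigr => j _.
  by rewrite mxE.
rewrite cube_integral_sum; last first.
  by move=> i; apply: regular_sum => j; exact: regular_by_parts.
apply: big1 => i _; rewrite cube_integral_sum; last first.
  by move=> j; exact: regular_by_parts.
by apply: big1 => j _; apply: dirichlet_by_parts => //; exact: zero_on_bnd_faces.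
Qed.

(** Either alternative kills the flux through the faces orthogonal to the axis [k]: the first by the
    factor [A], the second by the [k]-th derivative of [B], which is the normal derivative there up
    to sign. The extension [G] stands for this derivative because [partial] is only controlled in
    the open cube. *)
Lemma divergence_Kgrad K A B :
  {within closed_cube c L, continuous K} -> reg 1 K ->
  (forall i j, {within closed_cube c L, continuous (fun x => A x i j)}) ->
  regular_tensor 1 A -> regular_tensor 2 B ->
  (forall i j, zero_on_bnd (fun x => A x i j)) \/
  (forall i j k, exists G, [/\ {within closed_cube c L, continuous G},
     forall x, cube c L x -> partial k (fun y => B y i j) x = G x &
     zero_on_faces c L k G]) ->
  I (fun x => frob (A x) (divKgrad K B x) + K x * dot_grad A B x) = 0.
Proof.
move=> cK rK cA rA rB bc.
have rKB i j k : reg 1 (fun y => K y * partial k (fun z => B z i j) y).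
  by apply: regularM => //; exact: regular_partial.
pose F i j k x := A x i j *
    partial k (fun y => K y * partial k (fun z => B z i j) y) x +
  (K x * partial k (fun z => B z i j) x) * partial k (fun y => A y i j) x.
have rF i j k : reg 0 (F i j k) by exact: regular_by_parts.
rewrite (@eq_cube_integral _ _ _ _ _ (fun x => \sum_i \sum_j \sum_k F i j k x));
  last first.
  move=> x cx; rewrite frobE mulr_sumr -big_split/=; apply: eq_bigr => i _.
  rewrite mulr_sumr -big_split/=; apply: eq_bigr => j _.
  rewrite mxE !mulr_sumr -big_split/=; apply: eq_bigr => k _.
  by rewrite /F; ring.
rewrite cube_integral_sum; last by move=> i; do 2!(apply: regular_sum => ?).
apply: big1 => i _; rewrite cube_integral_sum; last first.
  by move=> j; apply: regular_sum.
apply: big1 => j _; rewrite cube_integral_sum; last by [].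
apply: big1 => k _; case: bc => [A0|/(_ i j k)[G [cG BG G0]]].
  by apply: dirichlet_by_parts => //; exact: zero_on_bnd_faces.
apply: (@cube_integral_by_parts _ _ _ _ _ _ (fun x => A x i j * (K x * G x))) => //.
- move=> x; exact: (continuousM (cA i j x) (continuousM (cK x) (cG x))).
- by move=> x cx; rewrite BG.
- by move=> x kx xk; rewrite G0// !mulr0.
Qed.

End vector_tensor_fields.

(** * The scheme *)

Section coefficients.
Context {R : realType} {d : nat} (P : sge_params R d).
Local Notation reg := (regular (corner P) (side P)).
Local Notation regt := (regular_tensor (corner P) (side P)).
Local Notation regv := (regular_vector (corner P) (side P)).
Hypothesis hP : sge_params_ok P.

Lemma regular_phi : reg 1 (phi P).
Proof. exact/Cclosed_regular/(phi_class hP). Qed.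

Lemma regular_mixture a b : reg 1 (fun x => a * phi P x + b * (1 - phi P x)).
Proof.
have rphi := regular_phi; apply: regularD; apply: regularZ => //.
by apply: regularB => //; exact: regular_cst.
Qed.

Lemma regular_b : reg 1 (b_coef P).
Proof.
by apply: regularZ; apply: regularB; [exact: regular_cst|exact: regular_phi].
Qed.

Lemma regular_eta : reg 1 (eta_coef P). Proof. exact: regular_mixture. Qed.
Lemma regular_Gamma : reg 1 (Gamma_Q P). Proof. exact: regular_mixture. Qed.
Lemma regular_N : reg 1 (N_coef P). Proof. exact: regular_mixture. Qed.
Lemma regular_xi : reg 1 (xi_coef P). Proof. exact/regularZ/regular_phi. Qed.
Lemma regular_chi : reg 1 (chi_coef P). Proof. exact/regularZ/regular_phi. Qed.
Lemma regular_K : reg 1 (K_coef P). Proof. exact/regularZ/regular_phi. Qed.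

Lemma continuous_K : {within closed_Omega P, continuous (K_coef P)}.
Proof.
have [cphi _] := phi_class hP.
have cc : {within closed_Omega P, continuous (fun=> K_fluid P : R)}.
  by move=> x; exact: cvg_cst.
by move=> x; exact: (continuousM (cc x) (cphi x)).
Qed.

Lemma regular_W : reg 0 (W_coef P).
Proof.
apply: regularZ; apply: regular_sqrt.
by apply: regular_dotv; apply: regular_grad; exact: regular_phi.
Qed.

(** Also used for [gamma_coef], which is the same function by definition. *)
Lemma regular_beta : reg 0 (beta_coef P).
Proof. exact/regularZ/regular0/regular_N. Qed.

Lemma regular_alpha : reg 0 (alpha_coef P).
Proof.
apply: regularZ; apply: regularB; first exact: regular_cst.
by apply: regularM; [exact: (regular0 regular_N)|exact: regular_cst].
Qed.

Lemma regular_Qstar : regt 0 (Qstar P).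
Proof. by move=> i j; exact/Cclosed_regular/(Qstar_class hP). Qed.

Lemma regular_f_bulk (Q : 'rV[R]_d -> 'M[R]_d) : regt 0 Q ->
  regt 0 (fun x => f_bulk (alpha_coef P x) (beta_coef P x) (gamma_coef P x) (Q x)).
Proof.
move=> rQ; have rQQ := regular_tensorM rQ rQ; have rtr := regular_trace rQQ.
apply: regular_tensorD; first apply: regular_tensorB.
- by apply: regular_tensorZ => //; exact: regular_alpha.
- apply: regular_tensorZ; first exact: regular_beta.
  apply: regular_tensorB => //; apply: regular_scalar_mx.
  by apply: regularM => //; exact: regular_cst.
- by apply: regular_tensorZ => //; apply: regularM => //; exact: regular_beta.
Qed.

Lemma regular_f_bulk_polarized (U V W : 'rV[R]_d -> 'M[R]_d) :
  regt 0 U -> regt 0 V -> regt 0 W ->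
  regt 0 (fun x => f_bulk_polarized (alpha_coef P x) (beta_coef P x)
    (gamma_coef P x) (U x) (V x) (W x)).
Proof.
move=> rU rV rW; rewrite /f_bulk_polarized.
have rc a : reg 0 (fun=> a) by exact: regular_cst.
have rM : regt 0 (fun x => 2^-1 *: (U x + W x)).
  by apply: regular_tensorZ => //; exact: regular_tensorD.
have rVV := regular_tensorM rV rV.
apply: regular_tensorD; first apply: regular_tensorB.
- by apply: regular_tensorZ => //; apply: regularM => //; exact: regular_alpha.
- apply: regular_tensorZ; first by apply: regularM => //; exact: regular_beta.
  apply: regular_tensorB.
    by apply: regular_tensorD; [apply: regular_tensorD|]; do ?[exact: regular_tensorM].
  apply: regular_scalar_mx; apply: regularM => //; apply: regular_trace.
  by apply: regular_tensorM => //; apply: regular_tensorD => //; exact: regular_tensorD.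
- apply: regular_tensorZ => //; apply: regularM; last exact: regular_trace.
  by apply: regularM => //; exact: regular_beta.
Qed.

Lemma regular_F_bulk (U V : 'rV[R]_d -> 'M[R]_d) : regt 0 U -> regt 0 V ->
  reg 0 (fun x => F_bulk_polarized_density (alpha_coef P x) (beta_coef P x)
    (gamma_coef P x) (U x) (V x)).
Proof.
move=> rU rV; rewrite /F_bulk_polarized_density.
have rc a : reg 0 (fun=> a) by exact: regular_cst.
have rUU := regular_trace (regular_tensorM rU rU).
have rVV := regular_trace (regular_tensorM rV rV).
apply: regularD; first apply: regularB.
- apply: regularM; first by apply: regularM => //; exact: regular_alpha.
  by apply: regularM => //; exact: regularD.
- apply: regularM; first by apply: regularM => //; exact: regular_beta.
  apply: regular_trace; apply: regular_tensorM; first exact: regular_tensorM.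
  by apply: regular_tensorZ => //; exact: regular_tensorD.
- apply: regularM => //; apply: regularM => //.
  by apply: regularM => //; exact: regular_beta.
Qed.

Lemma regular_mol_field (Q : 'rV[R]_d -> 'M[R]_d) : regt 2 Q ->
  regt 0 (mol_field P Q).
Proof.
move=> rQ; have rQ0 : regt 0 Q by move=> i j; exact: regular0 (rQ i j).
apply: regular_tensorB; first apply: regular_tensorB.
- by apply: regular_divKgrad => //; exact: regular_K.
- exact: regular_f_bulk.
- apply: regular_tensorZ; first exact: regular_W.
  by apply: regular_tensorB => //; exact: regular_Qstar.
Qed.

Lemma regular_S_term (v : 'rV[R]_d -> 'rV[R]_d) (Q : 'rV[R]_d -> 'M[R]_d) :
  regv 1 v -> regt 0 Q -> regt 0 (S_term P v Q).
Proof.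
move=> rv rQ; rewrite /S_term.
have rc a : reg 0 (fun=> a) by exact: regular_cst.
have rD := regular_strain rv; have rO := regular_vorticity rv.
apply: regular_tensorB; first apply: regular_tensorD; first apply: regular_tensorD.
- by apply: regular_tensorB; exact: regular_tensorM.
- by apply: regular_tensorZ => //; apply: regular_tensorD; exact: regular_tensorM.
- exact: regular_tensorZ.
- apply: regular_tensorZ; last first.
    by apply: regular_tensorD => //; exact: regular_scalar_mx.
  by apply: regularM => //; exact: regular_frob.
Qed.

End coefficients.

(** * Linear combinations of integrals *)

Section has_integral.
Context {R : realType} {d : nat} (c : 'rV[R]_d) (L : R).
Implicit Types (f g : 'rV[R]_d -> R) (r s a : R).

(** Pairing regularity with the value lets a long linear combination be integrated by one term that
    follows its shape, with the integrability conditions carried along. *)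
Definition has_integral f r := regular c L 0 f /\ cube_integral c L f = r.

Lemma has_integral_intro f : regular c L 0 f -> has_integral f (cube_integral c L f).
Proof. by []. Qed.

Lemma has_integralD f g r s : has_integral f r -> has_integral g s ->
  has_integral (fun x => f x + g x) (r + s).
Proof.
by move=> [rf <-] [rg <-]; split; [exact: regularD|exact: cube_integralD].
Qed.

Lemma has_integralZ a f r : has_integral f r -> has_integral (fun x => a * f x) (a * r).
Proof. by move=> [rf <-]; split; [exact: regularZ|exact: cube_integralZ]. Qed.

Lemma has_integralB f g r s : has_integral f r -> has_integral g s ->
  has_integral (fun x => f x - g x) (r - s).
Proof.
by move=> [rf <-] [rg <-]; split; [exact: regularB|exact: cube_integralB].
Qed.

Lemma has_integral_unique f g r s : (forall x, cube c L x -> f x = g x) ->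
  has_integral f r -> has_integral g s -> r = s.
Proof. by move=> fg [_ <-] [_ <-]; exact: eq_cube_integral. Qed.

End has_integral.

(** * Differences of squares *)

Section squares.
Context {R : realType} {d : nat}.
Implicit Types (u w : 'rV[R]_d) (A B S : 'M[R]_d).

Lemma dotv_sqr_diff u w :
  dotv u u - dotv w w = 2 * dotv (u - w) (2^-1 *: (u + w)).
Proof.
rewrite dotvZr !(dotvDl, dotvNl, dotvDr) (dotvC w u).
by field.
Qed.

(** The shift [S] is the preferred field [Qstar] for the anchoring energy, and the field at the
    middle time level for the stabilization term. *)
Lemma frob_sqr_diff A B S : frob (A - S) (A - S) - frob (B - S) (B - S) =
  2 * frob (A - B) (2^-1 *: (A + B) - S).
Proof.
rewrite !(frobDl, frobNl, frobDr, frobNr, frobZr).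
rewrite (frobC B A) (frobC S A) (frobC S B).
by field.
Qed.

End squares.

(** * Time averages of the fields *)

Section averages.
Context {R : realType} {d : nat} (c : 'rV[R]_d) (L : R).
Implicit Types (f g : 'rV[R]_d -> R).
Variables (v : nat -> 'rV[R]_d -> 'rV[R]_d) (Q : nat -> 'rV[R]_d -> 'M[R]_d) (n : nat).

Lemma within_continuousD (A : set 'rV[R]_d) f g :
  {within A, continuous f} -> {within A, continuous g} ->
  {within A, continuous (fun x => f x + g x)}.
Proof. by move=> cf cg x; exact: (continuousD (cf x) (cg x)). Qed.

Lemma within_continuousZ (A : set 'rV[R]_d) (a : R) f :
  {within A, continuous f} -> {within A, continuous (fun x => a * f x)}.
Proof.
move=> cf; have ca : {within A, continuous (fun=> a : R)} by move=> x; exact: cvg_cst.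
by move=> x; exact: (continuousM (ca x) (cf x)).
Qed.

Lemma bar_vectorE i : (fun x => bar v n x 0 i) =
  (fun x => 2^-1 * (v n.+1 x 0 i + v n.-1 x 0 i)).
Proof. by apply/funext => x; rewrite !mxE. Qed.

Lemma bar_tensorE i j : (fun x => bar Q n x i j) =
  (fun x => 2^-1 * (Q n.+1 x i j + Q n.-1 x i j)).
Proof. by apply/funext => x; rewrite !mxE. Qed.

Lemma regular_bar_vector m : regular_vector c L m (v n.+1) ->
  regular_vector c L m (v n.-1) -> regular_vector c L m (bar v n).
Proof.
by move=> r2 r0 i; rewrite bar_vectorE; apply: regularZ; exact: regularD.
Qed.

Lemma regular_bar_tensor m : regular_tensor c L m (Q n.+1) ->
  regular_tensor c L m (Q n.-1) -> regular_tensor c L m (bar Q n).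
Proof.
by move=> r2 r0 i j; rewrite bar_tensorE; apply: regularZ; exact: regularD.
Qed.

Lemma sqnorm_grad_diff x : cube c L x ->
  regular_tensor c L 1 (Q n.+1) -> regular_tensor c L 1 (Q n.-1) ->
  sqnorm_grad (Q n.+1) x - sqnorm_grad (Q n.-1) x =
  2 * dot_grad (fun y => Q n.+1 y - Q n.-1 y) (bar Q n) x.
Proof.
move=> cx r2 r0; rewrite /sqnorm_grad /dot_grad -sumrB mulr_sumr.
apply: eq_bigr => i _; rewrite -sumrB mulr_sumr; apply: eq_bigr => j _.
rewrite -sumrB mulr_sumr; apply: eq_bigr => k _.
rewrite bar_tensorE (partialZ _ _ (regularD (r2 i j) (r0 i j)))//.
rewrite (partialD _ (r2 i j) (r0 i j))//.
have -> : (fun y => (Q n.+1 y - Q n.-1 y) i j) = (fun y => Q n.+1 y i j - Q n.-1 y i j).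
  by apply/funext => y; rewrite !mxE.
rewrite (partialB _ (r2 i j) (r0 i j))//.
by field.
Qed.

End averages.

(** * Discrete chain rule for the energy density *)

Section energy.
Context {R : realType} {d : nat} (P : sge_params R d) (hP : sge_params_ok P).
Local Notation reg := (regular (corner P) (side P)).
Local Notation regt := (regular_tensor (corner P) (side P)).
Local Notation regv := (regular_vector (corner P) (side P)).
Variables (kappa : R).
Variables (v : nat -> 'rV[R]_d -> 'rV[R]_d) (Q : nat -> 'rV[R]_d -> 'M[R]_d).

(** [E_PDG] is a sum of two integrals; merging their integrands allows one pointwise identity for
    the whole energy. *)
Definition energy_density (n : nat) (x : 'rV[R]_d) : R :=
  2^-1 * ((dotv (v n.-1 x) (v n.-1 x) + dotv (v n x) (v n x)) / 2)
  + K_coef P x / 2 * ((sqnorm_grad (Q n.-1) x + sqnorm_grad (Q n) x) / 2)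
  + W_coef P x / 2 *
      ((frob (Q n.-1 x - Qstar P x) (Q n.-1 x - Qstar P x) +
        frob (Q n x - Qstar P x) (Q n x - Qstar P x)) / 2)
  + kappa / 4 * frob (Q n x - Q n.-1 x) (Q n x - Q n.-1 x)
  + F_bulk_polarized_density (alpha_coef P x) (beta_coef P x) (gamma_coef P x)
      (Q n.-1 x) (Q n x).

Lemma has_integral_energy n : regv 0 (v n.-1) -> regv 0 (v n) ->
  regt 1 (Q n.-1) -> regt 1 (Q n) ->
  has_integral (corner P) (side P) (energy_density n) (E_PDG P kappa v Q n).
Proof.
move=> rv0 rv1 rQ0 rQ1.
have rc a : reg 0 (fun=> a) by exact: regular_cst.
have rT0 : regt 0 (Q n.-1) by move=> i j; exact: regular0 (rQ0 i j).
have rT1 : regt 0 (Q n) by move=> i j; exact: regular0 (rQ1 i j).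
have rS := regular_Qstar hP.
apply: has_integralD; apply: has_integral_intro; last exact: regular_F_bulk.
apply: regularD; first apply: regularD; first apply: regularD.
- by apply: regularZ; apply: regularM => //; apply: regularD; exact: regular_dotv.
- apply: regularM; first by apply: regularM => //; exact: (regular0 (regular_K hP)).
  by apply: regularM => //; apply: regularD; exact: regular_sqnorm_grad.
- apply: regularM; first by apply: regularM => //; exact: regular_W.
  apply: regularM => //; apply: regularD;
    by apply: regular_frob; exact: regular_tensorB.
- by apply: regularZ; apply: regular_frob; exact: regular_tensorB.
Qed.

(** The factor 2 before the polarized discrete gradient in [H_bar] offsets the half in front of the
    product with [H_bar]. The last bracket is the product rule for a divergence: the energy contains
    gradients, whereas [H_bar] contains [divKgrad]. *)
Lemma energy_density_diff n x : Omega P x ->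
  regt 1 (Q n.+1) -> regt 1 (Q n.-1) ->
  sym_tracefree (Q n.+1 x) -> sym_tracefree (Q n.-1 x) ->
  energy_density n.+1 x - energy_density n x =
  2^-1 * dotv (v n.+1 x - v n.-1 x) (bar v n x)
  - 2^-1 * frob (Q n.+1 x - Q n.-1 x) (H_bar P kappa Q n x)
  + 2^-1 * (frob (Q n.+1 x - Q n.-1 x) (divKgrad (K_coef P) (bar Q n) x) +
            K_coef P x * dot_grad (fun y => Q n.+1 y - Q n.-1 y) (bar Q n) x).
Proof.
move=> Ox r2 r0 M2 M0; rewrite /energy_density /=.
(* Each chain rule is solved for its term at the later level, which leaves only earlier terms and
   products with increments. *)
have /eqP := F_bulk_polarized_diff (alpha_coef P x) (beta_coef P x)
  (gamma_coef P x) (Q n x) M0 M2.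
rewrite subr_eq => /eqP ->.
have /eqP := sqnorm_grad_diff Ox r2 r0; rewrite subr_eq => /eqP ->.
have /eqP := dotv_sqr_diff (v n.+1 x) (v n.-1 x); rewrite subr_eq => /eqP ->.
have /eqP := frob_sqr_diff (Q n.+1 x) (Q n.-1 x) (Qstar P x).
rewrite subr_eq => /eqP ->.
have /eqP := frob_sqr_diff (Q n.+1 x) (Q n.-1 x) (Q n x).
rewrite subr_eq => /eqP ->.
(* The identity with shift [Q n x] yields the opposite of this difference; the sign disappears in
   the square. *)
rewrite -[Q n x - Q n.-1 x]opprB frobNl frobNr opprK.
rewrite /H_bar -/(bar v n x) -/(bar Q n x) !(frobDr, frobNr, frobZr).
by field.
Qed.

End energy.

(** * Energy balance of one time step *)

Section step.
Context {R : realType} {d : nat} (P : sge_params R d) (hP : sge_params_ok P).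
Variables (Nt : nat) (tau kappa : R) (tau_gt0 : 0 < tau).
Variables (v : nat -> 'rV[R]_d -> 'rV[R]_d) (Q : nat -> 'rV[R]_d -> 'M[R]_d).
Variables (p : nat -> 'rV[R]_d -> R) (zeta omega : nat -> R).
Hypothesis hsol : sge_pdg_solution P Nt tau kappa v Q p zeta omega.
Variables (n : nat) (hn : (1 <= n < Nt)%N).
Local Notation c := (corner P).
Local Notation L := (side P).
Local Notation reg := (regular c L).
Local Notation regt := (regular_tensor c L).
Local Notation regv := (regular_vector c L).
Local Notation I := (integral_Omega P).
Local Notation vb := (bar v n).
Local Notation Qb := (bar Q n).
Local Notation H := (H_bar P kappa Q n).
Local Notation dQ := (fun y => Q n.+1 y - Q n.-1 y).

Let L0 : 0 < L := side_gt0 hP.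
Let n_le : (n <= Nt)%N. Proof. by have /andP[_ /ltnW] := hn. Qed.
Let n1_le : (n.+1 <= Nt)%N. Proof. by have /andP[_] := hn. Qed.
Let np_le : (n.-1 <= Nt)%N. Proof. exact: leq_trans (leq_pred n) n_le. Qed.
Let reg_sol := solution_regular hsol.
Let st := solution_step hsol hn.

Let rv m : (m <= Nt)%N -> regv 2 (v m).
Proof. by move=> mN i; exact/Cclosed_regular/(v_class reg_sol mN). Qed.

Let rQ m : (m <= Nt)%N -> regt 2 (Q m).
Proof. by move=> mN i j; exact/Cclosed_regular/(Q_class reg_sol mN). Qed.

Let rv1 m : (m <= Nt)%N -> regv 1 (v m).
Proof. by move=> mN i; apply: regularW; exact: rv. Qed.

Let rQ1 m : (m <= Nt)%N -> regt 1 (Q m).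
Proof. by move=> mN i j; apply: regularW; exact: rQ. Qed.

Let rv0 m : (m <= Nt)%N -> regv 0 (v m).
Proof. by move=> mN i; exact: regular0 (rv mN i). Qed.

Let rQ0 m : (m <= Nt)%N -> regt 0 (Q m).
Proof. by move=> mN i j; exact: regular0 (rQ mN i j). Qed.

Let rvb : regv 2 vb. Proof. by apply: regular_bar_vector; exact: rv. Qed.
Let rvb1 : regv 1 vb. Proof. by apply: regular_bar_vector; exact: rv1. Qed.
Let rvb0 : regv 0 vb. Proof. by apply: regular_bar_vector; exact: rv0. Qed.
Let rQb : regt 2 Qb. Proof. by apply: regular_bar_tensor; exact: rQ. Qed.
Let rQb0 : regt 0 Qb. Proof. by apply: regular_bar_tensor; exact: rQ0. Qed.
Let rdQ : regt 1 dQ. Proof. by apply: regular_tensorB; exact: rQ1. Qed.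
Let rp : reg 1 (p n). Proof. exact/Cclosed_regular/(p_class reg_sol hn). Qed.
Let rstrain : regt 1 (strain vb). Proof. exact: regular_strain. Qed.

Let rH : regt 0 H.
Proof.
apply: regular_tensorB; first apply: regular_tensorB; first apply: regular_tensorB.
- by apply: regular_divKgrad => //; exact: regular_K.
- apply: regular_tensorZ; first exact: regular_W.
  by apply: regular_tensorB => //; exact: regular_Qstar.
- apply: regular_tensorZ; first exact: regular_cst.
  by apply: regular_tensorB => //; exact: rQ0.
- apply: regular_tensorZ; first exact: regular_cst.
  by apply: regular_f_bulk_polarized => //; exact: rQ0.
Qed.

Let rmol : regt 0 (mol_field P (Q n)).
Proof. exact: (regular_mol_field hP (rQ n_le)). Qed.

Let rc : regv 0 (c_v P (v n) (Q n)).
Proof.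
apply: regular_vectorD; first apply: regular_vectorD.
- by apply: regular_vectorN; apply: regular_advect_vec; [exact: rv0|exact: rv1].
- apply: regular_divt => i j.
  (* The molecular field is only known to be regular of order 0, so the differentiability of the
     stress comes from its own assumption. *)
  exact: extends_Cclosed_regular (Sigma_class reg_sol hn i j).
- by apply: regular_vectorN; apply: regular_contract_grad => //; exact: rQ1.
Qed.

Let rC : regt 0 (C_Q P (v n) (Q n)).
Proof.
apply: regular_tensorD.
  by apply: regular_tensorN; apply: regular_advect_tensor; [exact: rv0|exact: rQ1].
by apply: regular_S_term; [exact: rv1|exact: rQ0].
Qed.

Let cont_vb i : {within closed_cube c L, continuous (fun x => vb x 0 i)}.
Proof.
rewrite bar_vectorE; apply: within_continuousZ; apply: within_continuousD.
  by have [] := v_class reg_sol n1_le i.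
by have [] := v_class reg_sol np_le i.
Qed.

Let vb_bnd i : zero_on_bnd c L (fun x => vb x 0 i).
Proof.
move=> x bx; rewrite /bar (v_boundary hsol n1_le bx) (v_boundary hsol np_le bx).
by rewrite addr0 scaler0 mxE.
Qed.

Let cont_Q m : (m <= Nt)%N ->
  forall i j, {within closed_cube c L, continuous (fun x => Q m x i j)}.
Proof. by move=> mN i j; have [] := Q_class reg_sol mN i j. Qed.

Let cont_dQ i j : {within closed_cube c L, continuous (fun x => dQ x i j)}.
Proof.
have -> : (fun x => dQ x i j) = (fun x => Q n.+1 x i j + (-1) * Q n.-1 x i j).
  by apply/funext => x; rewrite !mxE mulN1r.
by apply: within_continuousD; last apply: within_continuousZ; exact: cont_Q.
Qed.

Let neumann_extension m i j k : (m <= Nt)%N -> zero_neumann P (Q m) ->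
  exists G, [/\ {within closed_cube c L, continuous G},
    forall x, cube c L x -> partial k (fun y => Q m y i j) x = G x &
    zero_on_faces c L k G].
Proof.
move=> mN nQ; have [cQ /(_ k)[dQm [G [cG _] QG]]] := Q_class reg_sol mN i j.
exists G; split=> //; apply: (neumann_partial_eq0 L0 cQ dQm cG QG) => x nu xnu.
exact: nQ xnu i j.
Qed.

(** Matches the boundary conditions with the two alternatives of [divergence_Kgrad]: fixed data
    cancel in the increment, and the Neumann condition passes to the average by linearity. *)
Let Q_bc : (forall i j, zero_on_bnd c L (fun x => dQ x i j)) \/
  (forall i j k, exists G, [/\ {within closed_cube c L, continuous G},
     forall x, cube c L x -> partial k (fun y => Qb y i j) x = G x &
     zero_on_faces c L k G]).
Proof.
case: (Q_boundary hsol) => [[QD _ QQD]|nQ]; [left|right] => i j.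
  by move=> x bx; rewrite !QQD// subrr mxE.
move=> k; have [G2 [c2 Q2 z2]] := neumann_extension i j k n1_le (nQ _ n1_le).
have [G0 [c0 Q0 z0]] := neumann_extension i j k np_le (nQ _ np_le).
exists (fun x => 2^-1 * (G2 x + G0 x)); split.
- by apply: within_continuousZ; exact: within_continuousD.
- move=> x cx; have r2 := rQ1 n1_le i j; have r0 := rQ1 np_le i j.
  rewrite bar_tensorE (partialZ _ _ (regularD r2 r0))// (partialD _ r2 r0)//.
  by rewrite Q2// Q0.
- by move=> x kx xk; rewrite z2// z0// addr0 mulr0.
Qed.

(** This function and the next three are divergences expanded by the product rule. They collect
    everything by which the pointwise balance differs from the integrated one, and each has integral
    0. *)
Let pressure x := dotv (vb x) (grad (p n) x) + p n x * divv vb x.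
Let viscous x := dotv (vb x) (divt (fun y => eta_coef P y *: strain vb y) x) +
  frob (eta_coef P x *: strain vb x) (gradv vb x).
Let active x := dotv (vb x) (divt (fun y => chi_coef P y *: Q n y) x) +
  frob (chi_coef P x *: Q n x) (gradv vb x).
Let elastic x := frob (dQ x) (divKgrad (K_coef P) Qb x) +
  K_coef P x * dot_grad dQ Qb x.

Let integral_pressure : has_integral c L pressure 0.
Proof.
split; last exact: divergence_scalar.
apply: regularD; first by apply: regular_dotv => //; exact: regular_grad.
by apply: regularM; [exact: regularW|exact: regular_divv].
Qed.

Let integral_tensor T : regt 1 T -> has_integral c L
  (fun x => dotv (vb x) (divt T x) + frob (T x) (gradv vb x)) 0.
Proof.
move=> rT; split; last exact: divergence_tensor.
apply: regularD; first by apply: regular_dotv => //; exact: regular_divt.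
apply: regular_frob; last exact: regular_gradv.
by move=> i j; exact: regularW.
Qed.

Let integral_viscous : has_integral c L viscous 0.
Proof. by apply: integral_tensor; apply: regular_tensorZ => //; exact: regular_eta. Qed.

Let integral_active : has_integral c L active 0.
Proof.
by apply: integral_tensor; apply: regular_tensorZ; [exact: regular_chi|exact: rQ1].
Qed.

Let integral_elastic : has_integral c L elastic 0.
Proof.
have rK := regular_K hP; have cK := continuous_K hP.
split; last exact: divergence_Kgrad.
apply: regularD.
  apply: regular_frob; first by move=> i j; exact: regularW.
  exact: regular_divKgrad.
apply: regularM; first exact: regularW.
by apply: regular_dot_grad => // i j; exact: regularW.
Qed.

Let sqrt_scale_frob (K : R) (A : 'M[R]_d) : 0 <= K ->
  frob (Num.sqrt K *: A) (Num.sqrt K *: A) = K * frob A A.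
Proof. by move=> K0; rewrite frobZl frobZr mulrA -expr2 sqr_sqrtr. Qed.

Let sqrt_scale_dotv (K : R) (u : 'rV[R]_d) : 0 <= K ->
  dotv (Num.sqrt K *: u) (Num.sqrt K *: u) = K * dotv u u.
Proof. by move=> K0; rewrite dotvZl dotvZr mulrA -expr2 sqr_sqrtr. Qed.

(** Exposes the difference quotient in an increment, so that the evolution equations can be
    substituted. *)
Let two_tau (V : lmodType R) (u : V) : u = (2 * tau) *: ((2 * tau)^-1 *: u).
Proof. by rewrite scalerA mulfV ?scale1r// gt_eqF// mulr_gt0. Qed.

(** The scheme is inserted in the chain rule. Completing the viscous and active work to divergences
    leaves contractions with the velocity gradient, which reduce to the strain rate because the
    strain rate and [Q n x] are symmetric. *)
Lemma energy_density_step x : Omega P x ->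
  energy_density P kappa v Q n.+1 x - energy_density P kappa v Q n x =
  - 2 * tau * frob (Num.sqrt (eta_coef P x) *: strain vb x)
                   (Num.sqrt (eta_coef P x) *: strain vb x)
  - tau * dotv (Num.sqrt (b_coef P x) *: vb x) (Num.sqrt (b_coef P x) *: vb x)
  - tau * frob (Num.sqrt (Gamma_Q P x) *: H x) (Num.sqrt (Gamma_Q P x) *: H x)
  + tau * frob (Q n x) (chi_coef P x *: strain vb x - xi_coef P x *: H x)
  + tau * zeta n * (dotv (vb x) (c_v P (v n) (Q n) x) +
                    frob (- H x) (C_Q P (v n) (Q n) x))
  - tau * omega n * (dotv (vb x) (v n x) + frob (- H x) (G_Q P (Q n) x))
  - tau * pressure x + 2 * tau * viscous x - tau * active x + 2^-1 * elastic x.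
Proof.
move=> Ox.
have [M2 M0] := (Q_M0 hsol n1_le Ox, Q_M0 hsol np_le Ox).
have [symQ _] := Q_M0 hsol n_le Ox.
rewrite energy_density_diff//; do ?exact: rQ1.
have [[eta0 b0] Gamma0] := (eta_ge0 hP Ox, b_coef_ge0 hP Ox, Gamma_Q_ge0 hP Ox).
rewrite !sqrt_scale_frob// sqrt_scale_dotv//.
rewrite [v n.+1 x - v n.-1 x]two_tau (momentum st Ox).
(* The elastic divergence also contains the increment of [Q]; it is set aside so that the evolution
   equation is not substituted in it. *)
rewrite /elastic; set el := (frob _ (divKgrad _ _ x) + _).
rewrite [Q n.+1 x - Q n.-1 x]two_tau (Q_evolution st Ox).
rewrite /g_v /f_v /F_Q /pressure /viscous /active (incompressible st Ox).
have strain_grad : frob (strain vb x) (gradv vb x) = frob (strain vb x) (strain vb x).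
  exact: frob_strain_grad.
have Q_grad : frob (Q n x) (gradv vb x) = frob (Q n x) (strain vb x).
  by rewrite /strain frob_sym.
clearbody el; move: (strain vb x) (gradv vb x) strain_grad Q_grad.
(* From here on only bilinearity matters, so the values at [x] become arbitrary vectors and
   matrices. *)
move: (H x) (C_Q P (v n) (Q n) x) (G_Q P (Q n) x) (Q n x).
move: (vb x) (c_v P (v n) (Q n) x) (v n x) (grad (p n) x).
move: (divt _ x) (divt _ x) => dS dchi u cx vx gp h Cx Gx q S B strain_grad Q_grad.
rewrite !(dotvC u) !(dotvDl, dotvNl, dotvZl).
rewrite !(frobDl, frobNl, frobZl, frobDr, frobNr, frobZr) strain_grad Q_grad.
rewrite !(frobC h).
by field.
Qed.

Lemma normt_sqr T : normt P T ^+ 2 = innert P T T.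
Proof. by rewrite sqr_sqrtr//; apply: cube_integral_ge0 => x _; exact: frob_ge0. Qed.

Lemma normv_sqr u : normv P u ^+ 2 = innerv P u u.
Proof. by rewrite sqr_sqrtr//; apply: cube_integral_ge0 => x _; exact: dotv_ge0. Qed.

Lemma energy_law :
  E_PDG P kappa v Q n.+1 - E_PDG P kappa v Q n =
  - 2 * tau * normt P (fun x => Num.sqrt (eta_coef P x) *: strain vb x) ^+ 2
  - tau * normv P (fun x => Num.sqrt (b_coef P x) *: vb x) ^+ 2
  - tau * normt P (fun x => Num.sqrt (Gamma_Q P x) *: H x) ^+ 2
  + tau * innert P (Q n) (fun x => chi_coef P x *: strain vb x - xi_coef P x *: H x).
Proof.
have rS : regt 0 (strain vb) by move=> i j; exact: regularW.
have rsqrt T K : reg 1 K -> regt 0 T -> regt 0 (fun x => Num.sqrt (K x) *: T x).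
  by move=> rK rT; apply: regular_tensorZ => //; exact/regular_sqrt/regularW.
have rvis : regt 0 (fun x => Num.sqrt (eta_coef P x) *: strain vb x).
  by apply: rsqrt => //; exact: regular_eta.
have rGam : regt 0 (fun x => Num.sqrt (Gamma_Q P x) *: H x).
  by apply: rsqrt => //; exact: regular_Gamma.
have rfri : regv 0 (fun x => Num.sqrt (b_coef P x) *: vb x).
  move=> i; apply: (@eq_regular _ _ _ _ _
    (fun x => Num.sqrt (b_coef P x) * vb x 0 i)) => [x _|]; first by rewrite [RHS]mxE.
  by apply: regularM => //; exact/regular_sqrt/regularW/(regular_b hP).
have ract : regt 0 (fun x => chi_coef P x *: strain vb x - xi_coef P x *: H x).
  apply: regular_tensorB; apply: regular_tensorZ => //; apply: regularW.
    exact: regular_chi.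
  exact: regular_xi.
have rmH : regt 0 (fun x => - H x) by exact: regular_tensorN.
have rG : regt 0 (G_Q P (Q n)) by exact: regular_tensorN.
have hE m : (m <= Nt)%N -> (m.-1 <= Nt)%N ->
    has_integral c L (energy_density P kappa v Q m) (E_PDG P kappa v Q m).
  by move=> mN pN; apply: has_integral_energy => //;
    [exact: rv0|exact: rv0|exact: rQ1|exact: rQ1].
have hf T1 T2 : regt 0 T1 -> regt 0 T2 ->
    has_integral c L (fun x => frob (T1 x) (T2 x)) (innert P T1 T2).
  by move=> r1 r2; apply: has_integral_intro; exact: regular_frob.
have hd u1 u2 : regv 0 u1 -> regv 0 u2 ->
    has_integral c L (fun x => dotv (u1 x) (u2 x)) (innerv P u1 u2).
  by move=> r1 r2; apply: has_integral_intro; exact: regular_dotv.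
have hf2 T : regt 0 T -> has_integral c L (fun x => frob (T x) (T x)) (normt P T ^+ 2).
  by move=> rT; rewrite normt_sqr; exact: hf.
have hd2 u : regv 0 u -> has_integral c L (fun x => dotv (u x) (u x)) (normv P u ^+ 2).
  by move=> ru; rewrite normv_sqr; exact: hd.
(* With [a] and [b] the numerators of [zeta n] and [omega n] over the common denominator [G], both
   contributions equal [tau * a * b / G]. *)
have balance : tau * zeta n * (innerv P vb (c_v P (v n) (Q n)) +
      innert P (fun x => - H x) (C_Q P (v n) (Q n))) -
    tau * omega n * (innerv P vb (v n) + innert P (fun x => - H x) (G_Q P (Q n))) = 0.
  have cancel (a b G z w : R) : z = a / G -> w = b / G ->
      tau * z * b - tau * w * a = 0 by move=> -> ->; ring.
  exact: cancel (zeta_def st) (omega_def st).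
(* The nested term reproduces the right-hand side of the pointwise identity, summand by summand; the
   last four integrals are zero. *)
have -> := has_integral_unique energy_density_step
  (has_integralB (hE _ n1_le n_le) (hE _ n_le np_le))
  (has_integralD (has_integralB (has_integralD (has_integralB (has_integralB
  (has_integralD (has_integralD (has_integralB (has_integralB
    (has_integralZ (- 2 * tau) (hf2 _ rvis))
    (has_integralZ tau (hd2 _ rfri)))
    (has_integralZ tau (hf2 _ rGam)))
    (has_integralZ tau (hf _ _ (rQ0 n_le) ract)))
    (has_integralZ (tau * zeta n) (has_integralD (hd _ _ rvb0 rc) (hf _ _ rmH rC))))
    (has_integralZ (tau * omega n)
       (has_integralD (hd _ _ rvb0 (rv0 n_le)) (hf _ _ rmH rG))))
    (has_integralZ tau integral_pressure))
    (has_integralZ (2 * tau) integral_viscous))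
    (has_integralZ tau integral_active))
    (has_integralZ 2^-1 integral_elastic)).
by rewrite !mulr0 !subr0 !addr0 -addrA balance addr0.
Qed.

End step.

(** * The discrete energy law and unconditional stability *)

Theorem theorem3p4 (R : realType) (d : nat) (hd : d = 2%N \/ d = 3%N)
    (P : sge_params R d) (hP : sge_params_ok P)
    (Nt : nat) (tau kappa : R) (htau : 0 < tau)
    (v : nat -> 'rV[R]_d -> 'rV[R]_d) (Q : nat -> 'rV[R]_d -> 'M[R]_d)
    (p : nat -> 'rV[R]_d -> R) (zeta omega : nat -> R)
    (hsol : sge_pdg_solution P Nt tau kappa v Q p zeta omega) :
  (forall n, (1 <= n <= Nt - 1)%N ->
     E_PDG P kappa v Q n.+1 - E_PDG P kappa v Q n =
     - 2 * tau *
         normt P (fun x => Num.sqrt (eta_coef P x) *: strain (bar v n) x) ^+ 2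
     - tau * normv P (fun x => Num.sqrt (b_coef P x) *: bar v n x) ^+ 2
     - tau * normt P (fun x => Num.sqrt (Gamma_Q P x) *: H_bar P kappa Q n x) ^+ 2
     + tau * innert P (Q n)
         (fun x => chi_coef P x *: strain (bar v n) x - xi_coef P x *: H_bar P kappa Q n x))
  /\
  ((forall x, Omega P x -> chi_coef P x = 0 /\ xi_coef P x = 0) ->
   forall n, (1 <= n <= Nt - 1)%N ->
     E_PDG P kappa v Q n.+1 <= E_PDG P kappa v Q n).
Proof.
(* The subtraction is truncated: for [Nt = 0] the upper bound is 0 and the range is empty. *)
have in_range n : (1 <= n <= Nt - 1)%N -> (1 <= n < Nt)%N.
  by case: n Nt {hsol} => [|n] [|N]//; rewrite subn1.
have law n (hn : (1 <= n <= Nt - 1)%N) :=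
  energy_law hP htau hsol (in_range n hn).
split=> // passive n hn; rewrite -subr_le0 law//.
(* In the passive case the integrand of the active power vanishes at every point of the domain. *)
rewrite [innert _ _ _](_ : _ = 0); last first.
  rewrite -[RHS](cube_integral0 (corner P) (side P)).
  apply: eq_cube_integral => x /passive[-> ->].
  by rewrite !scale0r subrr /frob mulmx0 mxtrace0.
have sqr_tau_ge0 a : 0 <= tau * a ^+ 2 by rewrite mulr_ge0 ?sqr_ge0// ltW.
(* Three squares with nonpositive factors remain, whatever the norms are. *)
move: (normt P _) (normv P _) (normt P _) => a b g.
by have := sqr_tau_ge0 a; have := sqr_tau_ge0 b; have := sqr_tau_ge0 g; lra.
Qed.
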